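(* Let $E\subset\mathbb{R}$ be a compact set such that $\partial E\equiv E\setminus E^{\mathrm{int}}$ has capacity zero, where $E^{\mathrm{int}}$ is the interior of $E$ in $\mathbb{R}$. Let $\mu$ be a measure on $\mathbb{R}$ of compact support with $\sigma_{\mathrm{ess}}(d\mu)=E$ and $$d\mu=f(x)\,d\rho_E+d\mu_{\mathrm{s}},$$ where $\mu_{\mathrm{s}}$ is $d\rho_E$-singular. Suppose $f(x)>0$ for $d\rho_E$-a.e. $x$. Then $\mu$ is regular, i.e. $\lim_{n\to\infty}(a_1\cdots a_n)^{1/n}=C(E)$.
   Context: Measures are positive, finite, not necessarily normalized. For $\mu$ of compact infinite support on $\mathbb{R}$ with normalized orthogonal polynomials $p_n$, the Jacobi parameters $\{a_n,b_n\}_{n\ge1}$ are defined by $xp_n(x)=a_{n+1}p_{n+1}(x)+b_{n+1}p_n(x)+a_np_{n-1}(x)$ with $a_n>0$; equivalently the monic orthogonal polynomial of degree $n$ has $L^2(d\mu)$-norm $\mu(\mathbb{R})^{1/2}a_1\cdots a_n$. $\sigma_{\mathrm{ess}}(d\mu)$ is the essential spectrum of multiplication by $x$ on $L^2(d\mu)$, i.e. the set of non-isolated points of $\mathrm{supp}(d\mu)$. $C(E)$ is the logarithmic capacity of $E$, and $d\rho_E$ is its potential-theoretic equilibrium measure (it is implicit that $C(E)>0$, so that $\rho_E$ is defined). *)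

(* Defs.v *)
From mathcomp Require Import all_boot all_order all_algebra.
From mathcomp Require Import all_classical all_reals all_analysis.

Set Implicit Arguments.
Unset Strict Implicit.
Unset Printing Implicit Defensive.

Import Order.TTheory GRing.Theory Num.Theory.
Import numFieldNormedType.Exports.

Local Open Scope classical_set_scope.
Local Open Scope ring_scope.

Section potential_theory.
Context {R : realType}.
Local Open Scope ereal_scope.

(* The kernel is log (1 / |x - y|), with value +oo on the diagonal. *)
Definition log_energy (rho : probability (measurableTypeR R) R) : \bar R :=
  \int[rho]_x \int[rho]_y - lne `|x - y|%:E.

(* Intended for compact E; the value is +oo when E carries no probability
   measure of finite energy, and in particular when E is empty. *)
Definition robin_constant (E : set R) : \bar R :=
  ereal_inf [set log_energy rho |
             rho in [set rho : probability (measurableTypeR R) R | rho E = 1]].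

(* Since expeR -oo = 0, this is 0 when every measure on E has infinite
   energy. *)
Definition capacity (E : set R) : \bar R := expeR (- robin_constant E).

(* Meaningful only when 0 < capacity E, in which case the minimizer is
   unique. *)
Definition is_equilibrium_measure (E : set R)
    (rho : probability (measurableTypeR R) R) : Prop :=
  rho E = 1 /\ log_energy rho = robin_constant E.

End potential_theory.

Section measures_on_the_line.
Context {R : realType}.
Implicit Types mu nu : {measure set (measurableTypeR R) -> \bar R}.
Local Open Scope ereal_scope.

Definition msupport mu : set R :=
  [set x | forall U : set R, open U -> U x -> 0 < mu U].

(* For multiplication by x on L^2(mu): the non-isolated points of the
   support. *)
Definition ess_spectrum mu : set R := msupport mu `\` isolated (msupport mu).

Definition mutually_singular mu nu : Prop :=
  exists N : set (measurableTypeR R),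
    [/\ measurable N, mu N = 0 & nu (~` N) = 0].

End measures_on_the_line.

Section orthogonal_polynomials.
Context {R : realType}.
Implicit Types mu : {measure set (measurableTypeR R) -> \bar R}.

Definition orthonormal_polynomials mu (p : nat -> {poly R}) : Prop :=
  (forall n, size (p n) = n.+1 /\ 0 < lead_coef (p n)) /\
  (forall m n, (\int[mu]_x ((p m).[x] * (p n).[x])%:E = (m == n)%:R%:E)%E).

(* a n and b n are the Jacobi parameters for 1 <= n; a 0 and b 0 are unused.
   In the recurrence at n = 0, the term with p_{-1} = 0 is absent. *)
Definition jacobi_parameters mu (a b : nat -> R) : Prop :=
  exists p : nat -> {poly R},
    [/\ orthonormal_polynomials mu p,
        forall n, (0 < n)%N -> 0 < a n,
        'X * p 0%N = a 1%N *: p 1%N + b 1%N *: p 0%N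
      & forall n, (0 < n)%N ->
          'X * p n = a n.+1 *: p n.+1 + b n.+1 *: p n + a n *: p n.-1].

End orthogonal_polynomials.

(* Main.v *)
Require Import Defs.
From mathcomp Require Import all_boot all_order all_algebra.
From mathcomp Require Import complex.
From mathcomp Require Import all_classical all_reals all_analysis.
From mathcomp Require Import measurable_realfun ring lra zify.

(** Write [r] for the Robin constant of [E], so that the capacity is [exp (-
    r)], and [A_n] for [a_1 ... a_n]. Up to a constant factor, [A_n] is the
    least [L^2(mu)] norm of a monic polynomial of degree [n]. The theorem says
    that [ln A_n / n] tends to [- r].

    Lower bound. The potential of [rho] is at most [r] on an interval carrying
    [rho] ([frostman_maximum_principle]). Let [K] be the set where [f >=
    delta]; its [rho]-mass [kappa] is close to [1] for small [delta], because
    [f > 0] almost everywhere, and [mu >= delta * rho] on subsets of [K]. For a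
    monic [P] of degree [n], the convexity of [exp] (Jensen) bounds the
    integral of [P^2] over [K] below by the exponential of twice the [rho]-mean
    of [ln |P|] over [K], and this mean is [- 1 / kappa] times the sum, over
    the roots, of the potential of the restriction of [rho] to [K]. Moving the
    complex roots to this interval only decreases [|P|] on it
    ([monic_norm_ge_prod]), so the maximum principle bounds each of these
    potentials by little more than [r] and gives [A_n >= C * exp (- n * (r +
    e))] ([integral_monic_sqr_ge]).

    Upper bound. For every [c > exp (- r)] some monic [Q] of positive degree
    satisfies [|Q| < c ^ deg Q] on [E] ([exists_small_monic]). Otherwise one
    could choose points of [E] greedily, each at product distance at least [c ^
    n] from the [n] previous ones; their empirical measures would have discrete
    energy at most [- ln c], and a weak limit would be a probability measure on
    [E] of energy at most [- ln c < r]. The inequality [|Q| < c ^ deg Q]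
    persists on a neighbourhood of [E], outside of which the support of [mu]
    has finitely many points, since these are isolated and the support is
    compact. Powers of [Q], times a fixed polynomial vanishing at these points,
    times a bounded power of [X], are competitors showing [A_n <= C * c ^ n]
    ([norm_poly_le_eventually], [jacobi_prod_le]). *)

Set Implicit Arguments.
Unset Strict Implicit.
Unset Printing Implicit Defensive.

Import Order.TTheory GRing.Theory Num.Theory.
Import numFieldNormedType.Exports.

Local Open Scope classical_set_scope.
Local Open Scope ring_scope.

(** * Measure-theoretic and real preliminaries *)

Section measure_preliminaries.
Context {R : realType}.
Local Open Scope ereal_scope.

Lemma ae_impl d (X : measurableType d)
    (m : {measure set X -> \bar R}) (P Q : X -> Prop) :
  (forall x, P x -> Q x) -> {ae m, forall x, P x} -> {ae m, forall x, Q x}.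
Proof. by move=> PQ; apply: filterS. Qed.

Lemma ae_impl2 d (X : measurableType d)
    (m : {measure set X -> \bar R}) (P Q S : X -> Prop) :
  (forall x, P x -> Q x -> S x) ->
  {ae m, forall x, P x} -> {ae m, forall x, Q x} -> {ae m, forall x, S x}.
Proof. by move=> PQ; apply: filterS2. Qed.

(** This form allows the limit inequality to fail on a null set, which is how
    Fatou's lemma is used for sequences that converge only almost everywhere.
    *)
Lemma ae_fatou d (X : measurableType d)
    (m : {measure set X -> \bar R}) (u : nat -> X -> \bar R) (f : X -> \bar R) :
  (forall n, measurable_fun [set: X] (u n)) ->
  (forall n x, 0 <= u n x) ->
  measurable_fun [set: X] f -> (forall x, 0 <= f x) ->
  {ae m, forall x, f x <= limn_einf (u ^~ x)} ->
  \int[m]_x f x <= limn_einf (fun n => \int[m]_x u n x).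
Proof.
move=> mu u0 mf f0 uf.
have mlim : measurable_fun [set: X] (fun x => limn_einf (u ^~ x)).
  have -> : (fun x => limn_einf (u ^~ x)) =
      fun x => - limn_esup ((fun n => \- u n) ^~ x).
    apply/funext => x; rewrite -limn_einfN; congr limn_einf.
    by apply/funext => n /=; rewrite oppeK.
  apply: (measurableT_comp (@oppe_measurable _ setT)).
  apply: measurable_fun_limn_esup => n.
  exact: (measurableT_comp (@oppe_measurable _ setT)).
apply: le_trans (fatou _ measurableT mu _) => //.
apply: ae_ge0_le_integral => //.
  move=> x _; rewrite limn_einf_lim; apply: lime_ge; first exact: is_cvg_einfs.
  by apply: nearW => n; apply: le_ereal_inf_tmp => _ [k _ <-].
by move: uf; apply: ae_impl.
Qed.

Lemma limn_einf_le (u : nat -> \bar R) (c : \bar R) :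
  (forall n, u n <= c) -> limn_einf u <= c.
Proof.
move=> uc; rewrite limn_einf_lim; apply: lime_le; first exact: is_cvg_einfs.
apply: nearW => n; apply: le_trans (uc n).
by apply: ereal_inf_lbound; exists n => //=.
Qed.

Lemma prob_ae_ex d (X : measurableType d)
    (P : probability X R) (A : X -> Prop) :
  {ae P, forall x, A x} -> exists x, A x.
Proof.
move=> [N [mN N0 AN]]; apply: contrapT => /forallNP nA.
have : P setT <= P N by rewrite le_measure ?inE// => x _; apply: AN; exact: nA.
by rewrite N0 probability_setT leNgt lte01.
Qed.

Lemma prob_ae d (X : measurableType d) (P : probability X R) (A : set X) :
  measurable A -> P A = 1 -> {ae P, forall x, A x}.
Proof.
move=> mA PA; exists (~` A); split => //; first exact: measurableC.
by rewrite probability_setC// PA subee.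
Qed.

Lemma measurable_lne : measurable_fun [set: \bar R] (@lne R).
Proof.
have -> : @lne R = fun x : \bar R => if x <= 0 then -oo else
    if x == +oo then +oo else (ln (fine x))%:E.
  by apply/funext => -[r| |]/=; rewrite ?lee_fin ?leNye ?leye_eq//; case: ifP.
apply: measurable_fun_ifT => //; first exact: measurable_fun_lee.
apply: measurable_fun_ifT => //.
  exact: measurable_fun_eqe.
apply/measurable_EFinP.
apply: (measurableT_comp (@measurable_ln R)).
exact: fine_measurable.
Qed.

(** The function may be non-integrable and [c] negative, so linearity of the
    integral is not available: the negative part of [f + c] has integral at
    most [- c], and the identity follows by rearranging nonnegative integrals.
    *)
Lemma integral_ge0_shift d (X : measurableType d) (P : probability X R)
    (f : X -> \bar R) (c : R) : measurable_fun [set: X] f ->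
  (forall x, 0 <= f x) ->
  \int[P]_x (f x + c%:E) =
    \int[P]_x f x + c%:E.
Proof.
move=> mf f0.
have icst (r : R) : \int[P]_x (cst r%:E x) = r%:E.
  by rewrite integral_cst//= probability_setT mule1.
have [c0|c0] := leP 0%R c.
  by rewrite ge0_integralD// icst.
pose g x := f x + c%:E.
have mg : measurable_fun [set: X] g by exact: emeasurable_funD.
have gE x : g^\+ x + (- c)%:E = f x + g^\- x.
  rewrite funeposE funenegE /g; have := f0 x.
  case: (f x) => [r| |]//= r0.
    rewrite -!EFinD -!EFin_max -!EFinD; congr EFin.
    by have [h|h] := leP 0%R (r + c)%R;
      [rewrite max_r ?max_l|rewrite max_l ?max_r]; lra.
  by rewrite addye// max_r ?leNye//.
have gn x : g^\- x <= (- c)%:E.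
  rewrite funenegE /g ge_max lee_fin oppr_ge0 (ltW c0) andbT.
  have := f0 x; case: (f x) => [r| |]//= r0; last by rewrite leNye.
  by rewrite lee_fin; move: r0; rewrite lee_fin; lra.
have : \int[P]_x (g^\+ x + (cst (- c)%:E x)) = \int[P]_x (f x + g^\- x).
  by apply: eq_integral => x _; exact: gE.
rewrite ge0_integralD//; last 2 first.
- exact: measurable_funepos.
- by move=> x _; rewrite lee_fin; lra.
rewrite ge0_integralD//; last exact: measurable_funeneg.
rewrite icst => h0.
have gnc : \int[P]_x g^\- x <= (- c)%:E.
  rewrite -(icst (- c)%R); apply: ge0_le_integral => //.
  - exact: measurable_funeneg.
have gn0 : 0 <= \int[P]_x g^\- x by exact: integral_ge0.
rewrite integralE -/g.
have gnf : \int[P]_x g^\- x \is a fin_num.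
  by rewrite ge0_fin_numE// (le_lt_trans gnc)// ltry.
move: h0; rewrite -(fineK gnf) => h.
move: h; case: (\int[P]_x g^\+ x) => [p| |]; case: (\int[P]_x f x) => [q| |]//=.
by rewrite -!EFinD => -[?]; congr EFin; lra.
Qed.

End measure_preliminaries.

Section real_preliminaries.
Context {R : realType}.
Local Notation T := (measurableTypeR R).

Lemma dist_lt_above (x s i e : R) :
  i <= x -> x <= s -> s < i + e -> `|s - x| < e.
Proof. by move=> ix xs si; rewrite ger0_norm; lra. Qed.

Lemma dist_lt_below (x s i e : R) :
  x <= i -> s <= x -> i - e < s -> `|s - x| < e.
Proof. by move=> ix xs si; rewrite ler0_norm; lra. Qed.

Lemma ln_prod (I : eqType) (s : seq I) (F : I -> R) :
  (forall z, z \in s -> 0 < F z) ->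
  ln (\prod_(z <- s) F z) = \sum_(z <- s) ln (F z).
Proof.
elim: s => [|z s IH] F0; first by rewrite !big_nil ln1.
have F0' y : y \in s -> 0 < F y by move=> ys; apply: F0; rewrite inE ys orbT.
rewrite !big_cons lnM ?IH//.
- by rewrite posrE F0// mem_head.
- by rewrite posrE big_seq prodr_gt0.
Qed.

Lemma measurable_horner (P : {poly R}) :
  measurable_fun [set: T] (fun x : R => P.[x]).
Proof. by apply: continuous_measurable_fun => x; exact: continuous_horner. Qed.

Lemma open_horner_norm_lt (Q : {poly R}) (c : R) : open [set x | `|Q.[x]| < c].
Proof.
rewrite (_ : [set _ | _] = (fun x => `|Q.[x]|) @^-1` [set y | y < c])//.
apply: open_comp; last exact: open_lt.
move=> x _; apply: continuous_comp; first exact: continuous_horner.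
exact: norm_continuous.
Qed.

End real_preliminaries.

(** * The truncated logarithmic kernel *)

Section kernel.
Context {R : realType}.
Local Notation T := (measurableTypeR R).
Implicit Types D x y : R.

(** The kernel [ln (D / |x - y|)] cut off below at [0]. When [D] bounds the
    diameter of the set under study the cut-off is never active there, and the
    kernel only shifts energies by the constant [ln D]; being nonnegative
    everywhere, it can be integrated without integrability conditions. *)
Definition log_kernel D x y : \bar R :=
  if x == y then +oo%E else (Num.max 0 (ln D - ln `|x - y|))%:E.

Lemma log_kernel_ge0 D x y : (0 <= log_kernel D x y)%E.
Proof.
by rewrite /log_kernel; case: ifP => // _; rewrite lee_fin le_max lexx.
Qed.

Lemma log_kernelC D x y : log_kernel D x y = log_kernel D y x.
Proof. by rewrite /log_kernel eq_sym distrC. Qed.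

Lemma log_kernelE D x y : 0 < D -> `|x - y| <= D ->
  log_kernel D x y = ((ln D)%:E - lne `|x - y|%:E)%E.
Proof.
move=> D0 xyD; rewrite /log_kernel.
have [->|xy] := eqVneq x y; first by rewrite subrr normr0 /lne/= lexx.
have xy0 : 0 < `|x - y| by rewrite normr_gt0 subr_eq0.
rewrite lne_EFin// -EFinB; congr EFin.
by apply/max_idPr; rewrite subr_ge0 ler_ln.
Qed.

Lemma measurable_log_kernel2 D :
  measurable_fun [set: T * T] (fun z => log_kernel D z.1 z.2).
Proof.
apply: measurable_fun_ifT => //.
  exact: (measurable_fun_eqr measurable_fst measurable_snd).
apply/measurable_EFinP; apply: measurable_maxr => //.
apply: measurable_funB => //.
apply: (measurableT_comp (@measurable_ln R)).
apply: (measurableT_comp (@normr_measurable R setT)).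
exact: (measurable_funB measurable_fst measurable_snd).
Qed.

Lemma measurable_log_kernel D x : measurable_fun [set: T] (log_kernel D x).
Proof. exact: (measurable_fun_pair2 x (measurable_log_kernel2 D)). Qed.

Lemma measurable_log_kernel_l D y :
  measurable_fun [set: T] (fun x => log_kernel D x y).
Proof. exact: (measurable_fun_pair1 y (measurable_log_kernel2 D)). Qed.

Lemma cvg_log_kernel D (u v : nat -> R) x y : 0 < D ->
  u @ \oo --> x -> v @ \oo --> y ->
  (fun n => log_kernel D (u n) (v n)) @ \oo --> log_kernel D x y.
Proof.
move=> D0 ux vy.
have duv : (fun n => `|u n - v n|) @ \oo --> `|x - y|.
  by apply: cvg_norm; apply: cvgB.
rewrite {2}/log_kernel; case: eqVneq => [xy|xy].
  apply/cvgeyPge => A; move: duv; rewrite xy subrr normr0 => duv.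
  have e0 : 0 < D * expR (- A) by rewrite mulr_gt0 ?expR_gt0.
  near=> n.
  rewrite /log_kernel; case: eqVneq => [//|uvn]; first by rewrite leey.
  rewrite lee_fin le_max; apply/orP; right.
  have dn0 : 0 < `|u n - v n| by rewrite normr_gt0 subr_eq0.
  have : `|u n - v n| < D * expR (- A).
    near: n; have /cvgrPdist_lt/(_ _ e0) := duv.
    by apply: filterS => n /=; rewrite sub0r normrN normr_id.
  rewrite -ltr_ln ?posrE// lnM ?posrE ?expR_gt0// expRK => /ltW; lra.
have xy0 : 0 < `|x - y| by rewrite normr_gt0 subr_eq0.
have H : (fun n => (Num.max 0 (ln D - ln `|u n - v n|))%:E) @ \oo -->
   (Num.max 0 (ln D - ln `|x - y|))%:E.
  apply: cvg_EFin; first by near=> n.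
  apply: (@continuous_cvg _ _ _ _ _ _ (fun a : R^o => Num.max 0 a)).
    by apply: (@continuous_max R R^o (cst 0) id);
      [exact: cst_continuous|move=> ?].
  apply: cvgB; first exact: cvg_cst.
  by apply: continuous_cvg duv; exact: continuous_ln.
apply: cvg_trans H; apply: near_eq_cvg; near=> n.
rewrite /log_kernel ifF//; apply/negbTE; rewrite -subr_eq0 -normr_gt0.
near: n; exact: (cvgr_gt _ duv).
Unshelve. all: end_near. Qed.

(** Away from [y], [- ln |x - y|] is convex in [x], and a maximum with [0]
    keeps this. It controls a potential inside a gap of its measure by the
    values at the ends of the gap. *)
Lemma log_kernel_convex D (t l r y : R) : 0 < D -> 0 < t < 1 ->
  l <= r -> (y <= l) || (r <= y) ->
  (log_kernel D (t * l + (1 - t) * r)%R y <=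
   t%:E * log_kernel D l y + (1 - t)%:E * log_kernel D r y)%E.
Proof.
move=> D0 /andP[t0 t1] lr yo.
have t1' : 0 < 1 - t by rewrite subr_gt0.
have K0 (z : R) : (-oo < log_kernel D z y)%E.
  exact: lt_le_trans (log_kernel_ge0 _ _ _).
have [ly|ly] := eqVneq l y.
  rewrite {2}/log_kernel ly eqxx gt0_muley ?lte_fin// addye ?leey//.
  by rewrite -ltNye; apply: lt_le_trans (mule_ge0 _ (log_kernel_ge0 _ _ _));
    rewrite ?lee_fin ?ltW.
have [ry|ry] := eqVneq r y.
  rewrite {3}/log_kernel ry eqxx gt0_muley ?lte_fin// addey ?leey//.
  by rewrite -ltNye; apply: lt_le_trans (mule_ge0 _ (log_kernel_ge0 _ _ _));
    rewrite ?lee_fin ?ltW.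
have ly0 : 0 < `|l - y| by rewrite normr_gt0 subr_eq0.
have ry0 : 0 < `|r - y| by rewrite normr_gt0 subr_eq0.
have ab : `|t * l + (1 - t) * r - y| = t * `|l - y| + (1 - t) * `|r - y|.
  have [yl|ly'] := leP y l.
    rewrite !ger0_norm ?subr_ge0//; first ring.
    - exact: le_trans lr.
    - have : t * y + (1 - t) * y <= t * l + (1 - t) * r; last lra.
      apply: lerD; rewrite ler_wpM2l ?ltW//.
      by move: yl; rewrite le_eqVlt eq_sym (negbTE ly).
      by apply: lt_le_trans lr; move: yl; rewrite le_eqVlt eq_sym (negbTE ly).
  have ry' : r <= y by move: yo; rewrite leNgt ly'.
  rewrite !ler0_norm ?subr_le0//; first ring.
  - exact: ltW.
  - have : t * l + (1 - t) * r <= t * y + (1 - t) * y; last lra.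
    by apply: lerD; rewrite ler_wpM2l ?ltW// lt_neqAle ry.
have p0 : 0 < `|t * l + (1 - t) * r - y|.
  by rewrite ab addr_gt0// mulr_gt0.
rewrite /log_kernel (negbTE ly) (negbTE ry) ifF; last first.
  by apply/negbTE; rewrite -subr_eq0 -normr_gt0.
rewrite -!EFinM -EFinD lee_fin ge_max; apply/andP; split.
  by apply: addr_ge0; apply: mulr_ge0;
    rewrite ?(ltW t0) ?(ltW t1') ?le_max ?lexx.
have ti : 0 <= t <= 1 by rewrite (ltW t0) (ltW t1).
have := @concave_ln R (Itv01 (ltW t0) (ltW t1)) `|l - y| `|r - y| ly0 ry0.
rewrite !convRE/= ab => H.
have H1 : t * (ln D - ln `|l - y|) <= t * Num.max 0 (ln D - ln `|l - y|).
  by rewrite ler_wpM2l ?(ltW t0)// le_max lexx orbT.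
have H2 : (1 - t) * (ln D - ln `|r - y|) <=
    (1 - t) * Num.max 0 (ln D - ln `|r - y|).
  by rewrite ler_wpM2l ?(ltW t1')// le_max lexx orbT.
move: H; rewrite /unstable.onem; nra.
Qed.

End kernel.

(** * Potentials and energies *)

Section energy.
Context {R : realType}.
Local Notation T := (measurableTypeR R).
Local Open Scope ereal_scope.

Definition log_potential (m : {measure set T -> \bar R}) (D x : R) : \bar R :=
  \int[m]_y log_kernel D x y.

Lemma log_potential_ge0 m D x : 0 <= log_potential m D x.
Proof. by apply: integral_ge0 => y _; exact: log_kernel_ge0. Qed.

Lemma measurable_log_potential (m : {sigma_finite_measure set T -> \bar R}) D :
  measurable_fun [set: T] (log_potential m D).
Proof.
apply: (measurable_fun_fubini_tonelli_F _ (measurable_log_kernel2 D)) => z.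
exact: log_kernel_ge0.
Qed.

(** The kernel is symmetric, so this is Tonelli's theorem. *)
Lemma integral_log_potentialC
    (m1 m2 : {sigma_finite_measure set T -> \bar R}) D :
  \int[m1]_x log_potential m2 D x = \int[m2]_x log_potential m1 D x.
Proof.
rewrite /log_potential
  (fubini_tonelli _ (measurable_log_kernel2 D) (fun z => log_kernel_ge0 _ _ _)).
by apply: eq_integral => y _; apply: eq_integral => x _; exact: log_kernelC.
Qed.

Lemma log_energyE (rho : probability T R) (E : set T) (D : R) :
  measurable E -> rho E = 1 -> (0 < D)%R ->
  {in E &, forall x y, `|x - y| <= D}%R ->
  \int[rho]_x log_potential rho D x = log_energy rho + (ln D)%:E.
Proof.
move=> mE rhoE D0 ED.
pose k (z : T * T) := - lne `|z.1 - z.2|%:E.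
have mk : measurable_fun [set: T * T] k.
  apply: (measurableT_comp (@oppe_measurable _ setT)).
  apply: (measurableT_comp measurable_lne).
  apply/measurable_EFinP.
  apply: (measurableT_comp (@normr_measurable R setT)).
  exact: (measurable_funB measurable_fst measurable_snd).
have mU : measurable_fun [set: T] (fun x => \int[rho]_y - lne `|x - y|%:E).
  rewrite (_ : (fun _ => _) =
    fun x => fubini_F rho k^\+ x - fubini_F rho k^\- x).
    apply: emeasurable_funB; apply: measurable_fun_fubini_tonelli_F => //.
      exact: measurable_funepos.
    exact: measurable_funeneg.
  apply/funext => x; rewrite integralE /fubini_F.
  by congr (_ - _); apply: eq_integral => y _; rewrite ?funeposE ?funenegE.
have aeE := prob_ae mE rhoE.
have UE x : E x -> \int[rho]_y - lne `|x - y|%:E =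
    log_potential rho D x + (- ln D)%:E.
  move=> Ex; rewrite -integral_ge0_shift; last 2 first.
  - exact: measurable_log_kernel.
  - by move=> y; exact: log_kernel_ge0.
  apply: ae_eq_integral => //.
  - exact: (measurable_fun_pair2 x mk).
  - apply: emeasurable_funD => //; exact: measurable_log_kernel.
  apply: filterS aeE => y Ey _.
  rewrite log_kernelE// ?ED ?inE// addeAC -EFinD subrr add0e//.
have -> : log_energy rho = \int[rho]_x (log_potential rho D x + (- ln D)%:E).
  apply: ae_eq_integral => //.
  - apply: emeasurable_funD => //; exact: measurable_log_potential.
  by apply: filterS aeE => x Ex _; exact: UE.
rewrite integral_ge0_shift; last 2 first.
- exact: measurable_log_potential.
- by move=> x; exact: log_potential_ge0.
by rewrite -addeA -EFinD addNr adde0.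
Qed.

End energy.

(** * The maximum principle for the equilibrium potential *)

Section frostman.
Context {R : realType}.
Local Notation T := (measurableTypeR R).
Local Open Scope ereal_scope.
Variables (rho : probability T R) (E : set T) (D j : R).
Hypotheses (mE : measurable E) (rhoE : rho E = 1) (D0 : (0 < D)%R).
Hypothesis j_energy : \int[rho]_x log_potential rho D x = j%:E.
Hypothesis j_min : forall sigma : probability T R, sigma E = 1 ->
  j%:E <= \int[sigma]_x log_potential sigma D x.

(** First variation of the energy: compare [rho] with the normalization of [rho
    + t * rho|_B] and let [t] tend to [0]. Taking all sets [B] says that the
    potential is at least [j] almost everywhere, in integrated form. *)
Lemma energy_variation (B : set T) (mB : measurable B) :
  j%:E * rho B <= \int[mrestr rho mB]_x log_potential rho D x.
Proof.
pose mu := mrestr rho mB.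
have rB1 : rho B <= 1 by exact: probability_le1.
have rBf : rho B \is a fin_num.
  by rewrite ge0_fin_numE// (le_lt_trans rB1)// ltry.
pose b := fine (rho B).
have bE : rho B = b%:E by rewrite fineK.
have b0 : (0 <= b)%R by rewrite fine_ge0.
have b1 : (b <= 1)%R by rewrite -lee_fin -bE.
have le_mu (f : T -> \bar R) : measurable_fun setT f -> (forall x, 0 <= f x) ->
    \int[mu]_x f x <= \int[rho]_x f x.
  move=> mf f0; apply: ge0_le_measure_integral => // U mU.
  apply: (@le_measure _ _ _ rho (U `&` B)); rewrite ?inE//.
  exact: measurableI.
pose w := \int[mu]_x log_potential rho D x.
pose v := \int[mu]_x log_potential mu D x.
have w_j : w <= j%:E.
  rewrite -j_energy; apply: le_mu; first exact: measurable_log_potential.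
  by move=> x; exact: log_potential_ge0.
have wC : \int[rho]_x log_potential mu D x = w.
  exact: integral_log_potentialC.
have v_w : v <= w.
  rewrite -wC; apply: le_mu; first exact: measurable_log_potential.
  by move=> x; exact: log_potential_ge0.
have w0 : 0 <= w by apply: integral_ge0 => x _; exact: log_potential_ge0.
have v0 : 0 <= v by apply: integral_ge0 => x _; exact: log_potential_ge0.
have wf : w \is a fin_num by rewrite ge0_fin_numE// (le_lt_trans w_j)// ltry.
have vf : v \is a fin_num.
  by rewrite ge0_fin_numE// (le_lt_trans v_w)// -(fineK wf) ltry.
rewrite -/mu -/w.
(* [w] is the mutual energy of [rho] and [rho|_B], [v] the energy of [rho|_B];
   minimality of [j] is multiplied by the square of the total mass [1 + t * b].
   *)
have vary (t : R) : (0 < t)%R ->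
    (j * (1 + t * b) ^+ 2 <= j + 2 * t * fine w + t ^+ 2 * fine v)%R.
  move=> t0.
  pose tn := NngNum (ltW t0).
  pose m := measure_add rho (mscale tn mu).
  have mE' (U : set T) : m U = rho U + t%:E * rho (U `&` B).
    by rewrite /m /measure_add/= /msum !big_ord_recl big_ord0 adde0.
  pose s := (1 + t * b)^-1%R.
  have s0 : (0 < s)%R by rewrite invr_gt0; nra.
  have mT : m setT = (1 + t * b)%:E.
    by rewrite mE' setTI probability_setT bE -EFinM -EFinD.
  pose sn := NngNum (ltW s0).
  pose sigma : probability T R := mnormalize m rho.
  have sigmaE (U : set T) : sigma U = s%:E * m U.
    change ((if (m setT == 0) || (m setT == +oo) then [eta rho] else
      fun V => m V * ((fine (m setT))^-1)%:E) U = s%:E * m U).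
    rewrite mT ifF.
      by rewrite muleC.
    by apply/negbTE; rewrite negb_or andbT eqe; apply/negP => /eqP; nra.
  have int_sigma (f : T -> \bar R) : measurable_fun setT f ->
      (forall x, 0 <= f x) ->
      \int[sigma]_x f x = s%:E * (\int[rho]_x f x + t%:E * \int[mu]_x f x).
    move=> mf f0.
    rewrite (@eq_measure_integral _ _ _ _ (mscale sn m)); last first.
      by move=> A mA _; exact: sigmaE.
    rewrite ge0_integral_mscale// ge0_integral_measure_add//.
    by rewrite ge0_integral_mscale.
  have sigma_E : sigma E = 1.
    rewrite sigmaE mE' rhoE.
    have -> : rho (E `&` B) = rho B.
      apply/eqP; rewrite eq_le le_measure ?inE//=; last exact: measurableI.
      rewrite -(adde0 (rho (E `&` B))).
      have <- : rho (~` E) = 0 by rewrite probability_setC// rhoE subee.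
      apply: le_trans (measureU2 _ _ _) => //; last 2 first.
      - exact: measurableI.
      - exact: measurableC.
      rewrite le_measure ?inE//.
        by apply: measurableU; [exact: measurableI|exact: measurableC].
      by move=> x Bx; have [Ex|nEx] := pselect (E x); [left|right].
    rewrite bE; congr EFin; rewrite -[LHS]/(s * (1 + t * b))%R.
    by rewrite mulVf// gt_eqF//; nra.
  have potE x : log_potential sigma D x =
      s%:E * (log_potential rho D x + t%:E * log_potential mu D x).
    apply: int_sigma; first exact: measurable_log_kernel.
    by move=> y; exact: log_kernel_ge0.
  have mrho := measurable_log_potential rho D.
  have mmu := measurable_log_potential mu D.
  have p0 (mm : {measure set T -> \bar R}) x : 0 <= log_potential mm D x.
    exact: log_potential_ge0.
  have t0' : 0 <= t%:E by rewrite lee_fin ltW.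
  have mtmu : measurable_fun setT (fun x => t%:E * log_potential mu D x).
    exact: measurable_funeM.
  have split_int (nu : {measure set T -> \bar R}) :
      \int[nu]_x log_potential sigma D x =
      s%:E * (\int[nu]_x log_potential rho D x +
              t%:E * \int[nu]_x log_potential mu D x).
    under eq_integral do rewrite potE.
    rewrite ge0_integralZl//; last 3 first.
    - exact: emeasurable_funD.
    - by move=> x _; rewrite adde_ge0// mule_ge0.
    - by rewrite lee_fin ltW.
    rewrite ge0_integralD//; last by move=> x _; rewrite mule_ge0.
    by rewrite ge0_integralZl.
  have := j_min sigma_E.
  rewrite int_sigma; [|exact: measurable_log_potential|by []].
  rewrite !split_int j_energy wC -/w -/v -(fineK wf) -(fineK vf).
  rewrite -!(EFinM, EFinD) lee_fin => h.
  have sb : (s * (1 + t * b) = 1)%R by rewrite mulVf// gt_eqF//; nra.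
  have : (j * (1 + t * b) ^+ 2 <=
      (s * (s * (j + t * fine w) + t * (s * (fine w + t * fine v))))
      * (1 + t * b) ^+ 2)%R.
    by rewrite ler_wpM2r// sqr_ge0.
  move=> /le_trans; apply.
  rewrite [leLHS](_ : _ = (s * (1 + t * b)) ^+ 2 *
    (j + 2 * t * fine w + t ^+ 2 * fine v))%R; last by ring.
  by rewrite sb expr1n mul1r.
rewrite bE -(fineK wf) -EFinM lee_fin leNgt; apply/negP => wjb.
have j0 : (0 <= j)%R by move: (le_trans w0 w_j); rewrite lee_fin.
have v_j : (fine v <= j)%R by rewrite -lee_fin fineK// (le_trans v_w).
have fv0 : (0 <= fine v)%R by rewrite fine_ge0.
(* As [v <= j], the value [t = e / (j + 1)] is small enough for the linear term
   to dominate the quadratic one. *)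
pose e := (j * b - fine w)%R.
have e0 : (0 < e)%R by rewrite subr_gt0.
have t0 : (0 < e / (j + 1))%R by rewrite divr_gt0//; lra.
have := vary _ t0; set t := (_ / _)%R => h.
have te : (t * (j + 1) = e)%R by rewrite /t mulfVK// gt_eqF//; lra.
have : (t * (2 * e) <= t * (t * fine v - t * (j * b ^+ 2)))%R.
  rewrite /e; move: h; rewrite -subr_ge0 => h; rewrite -subr_ge0.
  by apply: le_trans h _; rewrite le_eqVlt; apply/orP; left; apply/eqP; ring.
rewrite ler_pM2l// => h2.
have : (t * fine v <= t * j)%R by rewrite ler_pM2l.
have : (0 <= t * (j * b ^+ 2))%R.
  by apply: mulr_ge0; [exact: ltW|apply: mulr_ge0 => //; exact: sqr_ge0].
move: te; rewrite mulrDr mulr1 => te.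
move=> h3 h4; have t0b : (0 < t)%R by [].
move: e0 te h2; clearbody e t; clear -h3 h4 t0b; lra.
Qed.

(** The mean of the potential is [j]. If it exceeded [j + e] on a set [C] of
    positive mass, its mean would exceed [j], because [energy_variation] bounds
    its integral over the complement of [C] below. *)
Lemma log_potential_ae_le : {ae rho, forall x, log_potential rho D x <= j%:E}.
Proof.
have mW := measurable_log_potential rho D.
have j0 : (0 <= j)%R.
  rewrite -lee_fin -j_energy; apply: integral_ge0 => x _.
  exact: log_potential_ge0.
have H (e : R) : (0 < e)%R ->
    rho [set x | (j + e)%:E <= log_potential rho D x] = 0.
  move=> e0; set C := [set x | _].
  have mC : measurable C by rewrite -[C]setTI; exact: emeasurable_fun_c_infty.
  have mC' := measurableC mC.
  have := energy_variation mC'.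
  have C1 : (j + e)%:E * rho C <= \int[mrestr rho mC]_x log_potential rho D x.
    apply: (@le_trans _ _ (\int[mrestr rho mC]_(x in C) log_potential rho D x));
      last first.
      apply: ge0_subset_integral => // x _; exact: log_potential_ge0.
    rewrite -[leLHS](_ : \int[mrestr rho mC]_(x in C) cst (j + e)%:E x = _).
      apply: ge0_le_integral => //.
      - by move=> x _ /=; rewrite lee_fin addr_ge0 // ltW.
      - exact: measurable_funTS.
    by rewrite integral_cst//= /mrestr setIid.
  move=> C2.
  have : (j + e)%:E * rho C + j%:E * rho (~` C) <= j%:E.
    apply: le_trans (leeD C1 C2) _.
    rewrite -ge0_integral_measure_add//; last first.
      by move=> x _; exact: log_potential_ge0.
    rewrite -j_energy le_eqVlt; apply/orP; left; apply/eqP.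
    apply: eq_measure_integral => A mA _.
    rewrite /measure_add/= /msum !big_ord_recl big_ord0 adde0/=.
    by rewrite (measureDI rho mA mC) addeC setDE.
  rewrite probability_setC//.
  have rC : rho C \is a fin_num by rewrite fin_num_measure.
  rewrite -(fineK rC) -EFinB -!EFinM -EFinD lee_fin => h.
  have c0 : (0 <= fine (rho C))%R by exact: fine_ge0.
  by congr EFin; apply/eqP; rewrite eq_le c0 andbT -(pmulr_rle0 _ e0); lra.
have aeN : {ae rho, forall x, forall n : nat,
    log_potential rho D x < (j + n.+1%:R^-1)%:E}.
  apply: ae_foralln => n; have en : (0 < n.+1%:R^-1 :> R)%R by rewrite invr_gt0.
  exists [set x | (j + n.+1%:R^-1)%:E <= log_potential rho D x]; split.
  - rewrite -[X in measurable X]setTI; exact: emeasurable_fun_c_infty.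
  - exact: H.
  - by move=> x /=/negP; rewrite -leNgt.
move: aeN; apply: ae_impl => x xn; apply/lee_addgt0Pr => e e0.
have [n ne] : exists n : nat, (n.+1%:R^-1 < e)%R.
  by have [N _ /(_ N (leqnn _))] := near_infty_natSinv_lt (PosNum e0); exists N.
by rewrite -EFinD (le_trans (ltW (xn n)))// lee_fin lerD2l ltW.
Qed.

(** Lower semicontinuity of the potential, by Fatou's lemma along a sequence of
    points of [S] converging to [x]. *)
Lemma log_potential_lsc (S : set R) (c : \bar R) x :
  (forall e : R, (0 < e)%R -> exists2 s, S s & (`|s - x| < e)%R) ->
  (forall s, S s -> log_potential rho D s <= c) ->
  log_potential rho D x <= c.
Proof.
move=> Sx Sc.
have /choice[s sP] : forall n : nat, exists s, S s /\ (`|s - x| < n.+1%:R^-1)%R.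
  by move=> n; have [|s Ss sx] := Sx n.+1%:R^-1%R; [rewrite invr_gt0|exists s].
have sx : s @ \oo --> x.
  apply/cvgrPdist_le => e e0; near=> n.
  rewrite distrC (le_trans (ltW (sP n).2))//.
  by apply: ltW; near: n; exact: near_infty_natSinv_lt (PosNum e0).
apply: (le_trans _ (limn_einf_le (fun n => Sc _ (sP n).1))).
apply: ae_fatou.
- by move=> n; exact: measurable_log_kernel.
- by move=> n y; exact: log_kernel_ge0.
- exact: measurable_log_kernel.
- by move=> y; exact: log_kernel_ge0.
- apply: aeW => y.
  by rewrite (cvg_limn_einf_sup (cvg_log_kernel D0 sx (@cvg_cst _ y _ _ _))).1.
Unshelve. all: end_near. Qed.

(** The bound holds on a set [S] of full measure, and at its limit points by
    lower semicontinuity. A point of the hull outside the closure of [S] lies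
    in a gap of [S] whose ends are limit points, and the potential is convex on
    the gap. *)
Lemma frostman_maximum_principle (lo hi : R) :
  (forall x, E x -> lo <= x <= hi)%R ->
  exists al be : R, {ae rho, forall x, al <= x <= be}%R /\
    forall x, (al <= x <= be)%R -> log_potential rho D x <= j%:E.
Proof.
move=> Elh.
pose S : set T := E `&` [set x | log_potential rho D x <= j%:E].
have aeS : {ae rho, forall x, S x}.
  apply: ae_impl2 (prob_ae mE rhoE) log_potential_ae_le => x Ex Wx; split => //.
have [s0 Ss0] : exists s, S s by exact: prob_ae_ex aeS.
have Slo : lbound S lo by move=> x [/Elh/andP[]].
have Shi : ubound S hi by move=> x [/Elh/andP[]].
have hS : has_sup S by split; [exists s0|exists hi].
have hI : has_inf S by split; [exists s0|exists lo].
exists (inf S), (sup S); split.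
  apply: (ae_impl _ aeS) => x Sx.
  by rewrite ge_inf ?ub_le_sup//; [exists hi|exists lo].
move=> x /andP[ax xb].
(* The ends of the gap are the supremum [l] of the part of [S] on the left of
   [x] and the infimum [r] of the part on the right. *)
pose A := S `&` [set y | y <= x]%R; pose B := S `&` [set y | x <= y]%R.
have Sj s : S s -> log_potential rho D s <= j%:E by case.
have [[sl [Sl1 Sl2]]|nA] := pselect (A !=set0); last first.
  apply: (log_potential_lsc _ Sj) => e e0.
  have [s Ss se] := inf_adherent e0 hI; exists s => //.
  have xs : (x < s)%R by rewrite ltNge; apply/negP => sx; apply: nA; exists s.
  exact: dist_lt_above ax (ltW xs) se.
have [[sr [Sr1 Sr2]]|nB] := pselect (B !=set0); last first.
  apply: (log_potential_lsc _ Sj) => e e0.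
  have [s Ss se] := sup_adherent e0 hS; exists s => //.
  have xs : (s < x)%R by rewrite ltNge; apply/negP => sx; apply: nB; exists s.
  exact: dist_lt_below xb (ltW xs) se.
have hA : has_sup A by split; [exists sl|exists x => y []].
have hB : has_inf B by split; [exists sr|exists x => y []].
set l := sup A; set r := inf B.
have lx : (l <= x)%R by apply: ge_sup => [|y []//]; exists sl.
have xr : (x <= r)%R by apply: lb_le_inf => [|y []//]; exists sr.
have Wl : log_potential rho D l <= j%:E.
  apply: (log_potential_lsc _ Sj) => e e0.
  have [s As se] := sup_adherent e0 hA; exists s; first by case: As.
  have sl' : (s <= l)%R by apply: ub_le_sup => //; exact: hA.2.
  exact: dist_lt_below (lexx l) sl' se.
have Wr : log_potential rho D r <= j%:E.
  apply: (log_potential_lsc _ Sj) => e e0.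
  have [s As se] := inf_adherent e0 hB; exists s; first by case: As.
  have sl' : (r <= s)%R by apply: ge_inf => //; exact: hB.2.
  exact: dist_lt_above (lexx r) sl' se.
have Slr y : S y -> ((y <= l) || (r <= y))%R.
  move=> Sy; have [yx|xy] := leP y x; apply/orP; [left|right].
    by apply: ub_le_sup; [exact: hA.2|split].
  by apply: ge_inf; [exact: hB.2|split => //; exact: ltW].
have [lxE|lx'] := eqVneq l x; first by rewrite -lxE.
have [rxE|rx'] := eqVneq r x; first by rewrite -rxE.
have {}lx : (l < x)%R by rewrite lt_neqAle lx'.
have {}xr : (x < r)%R by rewrite lt_neqAle eq_sym rx'.
pose t := ((r - x) / (r - l))%R.
have t01 : (0 < t < 1)%R.
  by rewrite divr_gt0 ?ltr_pdivrMr ?mul1r//; lra.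
have xE : x = (t * l + (1 - t) * r)%R by rewrite /t; field; lra.
have [t0 t1] := andP t01.
have t0' : 0 <= t%:E by rewrite lee_fin ltW.
have t1' : 0 <= (1 - t)%:E by rewrite lee_fin subr_ge0 ltW.
have mK z : measurable_fun [set: T] (log_kernel D z).
  exact: measurable_log_kernel.
have K0 z y : 0 <= log_kernel D z y by exact: log_kernel_ge0.
apply: (@le_trans _ _ (\int[rho]_y (t%:E * log_kernel D l y +
    (1 - t)%:E * log_kernel D r y))).
  apply: ae_ge0_le_integral => //.
  - by move=> y _; rewrite adde_ge0// mule_ge0.
  - by apply: emeasurable_funD; exact: measurable_funeM.
  apply: (ae_impl _ aeS) => y Sy _; rewrite {1}xE.
  apply: log_kernel_convex => //.
    by rewrite ltW// (lt_trans lx).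
  exact: Slr.
rewrite ge0_integralD//; last 4 first.
- by move=> y _; rewrite mule_ge0.
- exact: measurable_funeM.
- by move=> y _; rewrite mule_ge0.
- exact: measurable_funeM.
rewrite !ge0_integralZl// -!/(log_potential _ _ _).
apply: (@le_trans _ _ (t%:E * j%:E + (1 - t)%:E * j%:E)).
  by apply: leeD; rewrite lee_wpmul2l.
by rewrite -!EFinM -EFinD lee_fin; lra.
Qed.
End frostman.

(** * Lower bounds for mean squares of monic polynomials *)

Lemma dist_clamp_le (R : realDomainType) (al be x a : R) :
  al <= x <= be -> `|x - Num.max al (Num.min be a)| <= `|x - a|.
Proof.
move=> /andP[ax xb]; have [ba|ab] := leP be a.
  rewrite max_r ?(le_trans ax)//.
  by rewrite !ler0_norm; lra.
have [aa|aa] := leP al a; first by [].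
by rewrite !ger0_norm; lra.
Qed.

(** Replace each complex root by its real part and project the latter to the
    interval from [al] to [be]: both moves bring the root closer to every point
    of this interval. *)
Lemma monic_norm_ge_prod (R : rcfType) (P : {poly R}) (al be : R) :
  al <= be -> P \is monic ->
  exists s : seq R, [/\ size s = (size P).-1,
    forall z, z \in s -> al <= z <= be &
    forall x, al <= x <= be -> \prod_(z <- s) `|x - z| <= `|P.[x]| ].
Proof.
move=> ab Pm.
pose f : {rmorphism R -> complex R} := @real_complex R.
have [r rE] := closed_field_poly_normal (map_poly f P).
have lc1 : lead_coef (map_poly f P) = 1.
  by rewrite lead_coef_map (monicP Pm) rmorph1.
move: rE; rewrite lc1 scale1r => rE.
pose c (z : complex R) := Num.max al (Num.min be (complex.Re z)).
exists (map c r); split.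
- have := size_prod_XsubC r id; rewrite -rE size_map_poly size_map => -> //.
- move=> _ /mapP[z _ ->]; rewrite /c le_max lexx/= ge_max ab/= ge_min lexx//.
move=> x xab; rewrite big_map.
have : (`|P.[x]|)%:C%C = \prod_(z <- r) `|f x - z|.
  have -> : (`|P.[x]|)%:C%C = `|f P.[x]|.
    by rewrite normc_def/= expr0n/= addr0 sqrtr_sqr.
  rewrite -horner_map/= -[X in horner X]/(map_poly f P) rE.
  rewrite horner_prod normr_prod.
  by apply: eq_bigr => z _; rewrite hornerXsubC.
move=> PE; rewrite -lecR PE rmorph_prod/=.
apply: ler_prod => z _; rewrite lecR normr_ge0/=.
apply: le_trans (normc_ge_Re _); rewrite lecR.
rewrite raddfB/=; exact: dist_clamp_le.
Qed.

Section geometric_mean.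
Context {R : realType}.
Local Notation T := (measurableTypeR R).
Local Open Scope ereal_scope.

(** This is [exp u >= 1 + u] at [u = 2 * (ln |Q x| - m)], with [Q = \prod_z ('X
    - z)]. Written with the nonnegative kernel, it remains true when [x] is a
    root of [Q], and both sides can be integrated. *)
Lemma prod_dist_ge (D m x : R) (s : seq R) :
  (1 - 2 * m + 2 * (size s)%:R * ln D)%:E <=
  (expR (- (2 * m)) * (\prod_(z <- s) `|x - z|) ^+ 2)%:E
    + 2%:E * \sum_(z <- s) log_kernel D x z.
Proof.
have [xs|xs] := boolP (x \in s).
  have -> : \sum_(z <- s) log_kernel D x z = +oo.
    rewrite (big_rem x xs)/= {1}/log_kernel eqxx addye//.
    rewrite gt_eqF//; apply: (@lt_le_trans _ _ 0) => //.
    by apply: sume_ge0 => z _; exact: log_kernel_ge0.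
  by rewrite gt0_muley ?lte_fin// addey// leey.
have d0 z : z \in s -> (0 < `|x - z|)%R.
  by move=> zs; rewrite normr_gt0 subr_eq0; apply: contraNneq xs => ->.
have Q0 : (0 < \prod_(z <- s) `|x - z|)%R.
  by rewrite big_seq prodr_gt0.
apply: (@le_trans _ _ (
  (expR (- (2 * m)) * (\prod_(z <- s) `|x - z|) ^+ 2)%:E +
  2%:E * \sum_(z <- s) (ln D - ln `|x - z|)%:E)); last first.
  apply: leeD => //; apply: lee_wpmul2l => //.
  rewrite big_seq [leRHS]big_seq; apply: lee_sum => z zs.
  rewrite /log_kernel ifF ?lee_fin ?le_max ?lexx ?orbT//.
  by apply/negbTE; apply: contraNneq xs => ->.
rewrite sumEFin -EFinM -EFinD lee_fin sumrB -(ln_prod d0).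
rewrite big_const_seq count_predT iter_addr_0 -[X in (X ^+ 2)%R](lnK Q0).
rewrite -expRM_natl -expRD.
apply: le_trans (lerD (expR_ge1Dx _) (lexx _)).
by rewrite -mulr_natl; lra.
Qed.

Variables (rho : probability T R) (D j al be : R).
Hypothesis albe : {ae rho, forall x, al <= x <= be}%R.
Hypothesis pot_le :
  forall x, (al <= x <= be)%R -> log_potential rho D x <= j%:E.
Variables (K : set T) (mK : measurable K) (kappa : R).
Hypotheses (kappa0 : (0 < kappa)%R) (rhoK : rho K = kappa%:E).

Lemma interval_nonempty : exists x, (al <= x <= be)%R.
Proof. exact: (prob_ae_ex albe). Qed.

(** Jensen's inequality for [ln Q^2] on [K]: [prod_dist_ge] is integrated with
    the constant [m] for which the sum of the potentials at the roots, at most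
    [n * j], cancels the linear term. *)
Lemma integral_prod_dist_ge (s : seq R) :
  (forall z, z \in s -> al <= z <= be)%R ->
  (kappa * expR (2 * ((size s)%:R * (ln D - j / kappa))))%:E <=
  \int[mrestr rho mK]_x ((\prod_(z <- s) `|x - z|) ^+ 2)%:E.
Proof.
move=> sab; set n : R := (size s)%:R; set m := (n * _)%R.
pose nu := mrestr rho mK.
have int_cst (r : R) : \int[nu]_x (cst r%:E x) = (r * kappa)%:E.
  by rewrite integral_cst//= /mrestr setTI rhoK.
have mQ : measurable_fun [set: T] (fun x => ((\prod_(z <- s) `|x - z|) ^+ 2)%R).
  apply: measurable_funX; apply: measurable_prod => z _.
  apply: (measurableT_comp (@normr_measurable R setT)).
  exact: measurable_funB.
have mEQ : measurable_fun [set: T]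
    (fun x => ((\prod_(z <- s) `|x - z|) ^+ 2)%:E).
  exact/measurable_EFinP.
have Q0 x : 0 <= ((\prod_(z <- s) `|x - z|) ^+ 2)%:E by rewrite lee_fin sqr_ge0.
have mS : measurable_fun [set: T] (fun x => \sum_(z <- s) log_kernel D x z).
  by apply: emeasurable_sum => z; exact: measurable_log_kernel_l.
have S0 x : 0 <= \sum_(z <- s) log_kernel D x z.
  by apply: sume_ge0 => z _; exact: log_kernel_ge0.
have pots : \int[nu]_x \sum_(z <- s) log_kernel D x z <= (n * j)%:E.
  rewrite ge0_integral_sum//; last 2 first.
  - by move=> z; exact: measurable_log_kernel_l.
  - by move=> z x _; exact: log_kernel_ge0.
  apply: (@le_trans _ _ (\sum_(z <- s) j%:E)); last first.
    by rewrite sumEFin big_const_seq count_predT iter_addr_0 -mulr_natl.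
  rewrite big_seq [leRHS]big_seq; apply: lee_sum => z zs.
  apply: le_trans (pot_le (sab _ zs)).
  under eq_integral do rewrite log_kernelC.
  apply: ge0_le_measure_integral => //.
  - move=> S mS'; apply: (@le_measure _ _ _ rho (S `&` K)); rewrite ?inE//.
    exact: measurableI.
  - by move=> x; exact: log_kernel_ge0.
  - exact: measurable_log_kernel.
set e := expR (- (2 * m)).
have e0 : (0 < e)%R by exact: expR_gt0.
have j0 : (0 <= j)%R.
  have [x /pot_le] := interval_nonempty; rewrite -lee_fin; apply: le_trans.
  exact: log_potential_ge0.
have : \int[nu]_x (cst (1 - 2 * m + 2 * n * ln D)%:E x) <=
    \int[nu]_x (e%:E * ((\prod_(z <- s) `|x - z|) ^+ 2)%:E
    + 2%:E * \sum_(z <- s) log_kernel D x z).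
  apply: ge0_le_integral => //.
  - move=> x _; rewrite lee_fin /m.
    have -> : (1 - 2 * (n * (ln D - j / kappa)) + 2 * n * ln D =
      1 + 2 * n * (j / kappa))%R by ring.
    by rewrite addr_ge0// !mulr_ge0// ?ler0n// invr_ge0 ltW.
  - by apply: emeasurable_funD; exact: measurable_funeM.
  - by move=> x _; rewrite -EFinM; exact: prod_dist_ge.
rewrite int_cst ge0_integralD//; last 4 first.
- by move=> x _; rewrite mule_ge0// lee_fin ltW.
- exact: measurable_funeM.
- by move=> x _; rewrite mule_ge0.
- exact: measurable_funeM.
rewrite !ge0_integralZl//; last by rewrite lee_fin ltW.
have two0 : (0 : \bar R) <= 2%:E by rewrite lee_fin.
move=> /le_trans/(_ (leeD (lexx _) (lee_wpmul2l two0 pots))).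
have I0 : 0 <= \int[nu]_x ((\prod_(z <- s) `|x - z|) ^+ 2)%:E.
  exact: integral_ge0.
case: (\int[nu]_x _) I0 => [I| |]// I0; last by rewrite leey.
rewrite -!EFinM -EFinD !lee_fin => h.
have : (kappa <= e * I)%R.
  have -> : (kappa = (1 - 2 * m + 2 * n * ln D) * kappa - 2 * (n * j))%R.
    by rewrite /m; field; rewrite gt_eqF.
  by lra.
by rewrite -ler_pdivrMl// /e -expRN opprK mulrC.
Qed.

Lemma integral_monic_sqr_ge (mu : {measure set T -> \bar R}) (delta : R)
    (P : {poly R}) : (0 < delta)%R ->
  (forall A, measurable A -> A `<=` K -> delta%:E * rho A <= mu A) ->
  P \is monic ->
  (delta * kappa * expR (2 * ((size P).-1%:R * (ln D - j / kappa))))%:E <=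
  \int[mu]_x (P.[x] ^+ 2)%:E.
Proof.
move=> delta0 le_mu Pm.
have ab : (al <= be)%R by have [x /andP[/le_trans]] := interval_nonempty; apply.
have [s [sP sab sQ]] := monic_norm_ge_prod ab Pm.
rewrite -sP.
have mP : measurable_fun [set: T] (fun x => (P.[x] ^+ 2)%:E).
  by apply/measurable_EFinP; apply: measurable_funX; exact: measurable_horner.
have P0 x : 0 <= (P.[x] ^+ 2)%:E by rewrite lee_fin sqr_ge0.
pose nu := mscale (NngNum (ltW delta0)) (mrestr rho mK).
apply: (@le_trans _ _ (\int[nu]_x (P.[x] ^+ 2)%:E)).
  rewrite ge0_integral_mscale//= -mulrA EFinM.
  apply: lee_wpmul2l; first by rewrite lee_fin ltW.
  apply: le_trans (integral_prod_dist_ge sab) _.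
  apply: ae_ge0_le_integral => //.
  - by move=> x _; rewrite lee_fin sqr_ge0.
  - apply/measurable_EFinP; apply: measurable_funX.
    apply: measurable_prod => z _.
    apply: (measurableT_comp (@normr_measurable R setT)).
    exact: measurable_funB.
  have : {ae mrestr rho mK, forall x, al <= x <= be}%R.
    case: albe => N [mN N0 sN]; exists N; split => //.
    apply/eqP; rewrite eq_le measure_ge0 andbT -N0 /mrestr.
    by apply: le_measure; rewrite ?inE//; exact: measurableI.
  apply: ae_impl => x xab _.
  rewrite lee_fin -[leRHS]real_normK ?num_real// lerXn2r ?nnegrE ?prodr_ge0//.
  exact: sQ.
apply: ge0_le_measure_integral => // A mA.
apply: (@le_trans _ _ (mu (A `&` K))).
  apply: le_mu; [exact: measurableI|exact: subIsetr].
by apply: le_measure; rewrite ?inE//; exact: measurableI.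
Qed.

End geometric_mean.

(** * Greedy point sets *)

Section leja.
Context {R : realType}.

(** The kernel in which the self-interaction of a point is ignored, as in the
    discrete energy of a finite set of points. *)
Definition off_diagonal_kernel (D x y : R) : R :=
  if x == y then 0 else Num.max 0 (ln D - ln `|x - y|).

Lemma off_diagonal_kernel_ge0 D x y : 0 <= off_diagonal_kernel D x y.
Proof.
by rewrite /off_diagonal_kernel; case: ifP => // _; rewrite le_max lexx.
Qed.

Lemma off_diagonal_kernelC D x y :
  off_diagonal_kernel D x y = off_diagonal_kernel D y x.
Proof. by rewrite /off_diagonal_kernel eq_sym distrC. Qed.

Lemma off_diagonal_kernelE D x y : x != y ->
  (off_diagonal_kernel D x y)%:E = log_kernel D x y.
Proof. by rewrite /off_diagonal_kernel /log_kernel => /negbTE ->. Qed.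

Variables (E : set R) (D c : R).
Hypotheses (D0 : 0 < D) (c0 : 0 < c).
Hypothesis ED : forall x y, E x -> E y -> `|x - y| <= D.
Hypothesis spread : forall s : seq R, (forall z, z \in s -> E z) ->
  exists2 x, E x & c ^+ size s <= \prod_(z <- s) `|x - z|.

(** Greedy choice: the new point interacts with the [n] previous ones for at
    most [n * (ln D - ln c)], so the total grows like [n ^ 2] times [ln D - ln
    c]. The points are listed in increasing order so that the list is a
    quantile function of their empirical measure. *)
Lemma leja_energy n : exists t : seq R, [/\ size t = n, uniq t,
  sorted <=%R t, forall z, z \in t -> E z &
  \sum_(x <- t) \sum_(y <- t) off_diagonal_kernel D x y <=
    n%:R ^+ 2 * (ln D - ln c)].
Proof.
have cD : ln c <= ln D.
  have [//|x0 Ex0 _] := @spread [::].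
  have [|x Ex] := @spread [:: x0]; first by move=> z; rewrite inE => /eqP ->.
  rewrite big_seq1 expr1 => cx; rewrite ler_ln//.
  exact: le_trans cx (ED _ _).
suff [t [tn tu tE tD]] : exists t : seq R, [/\ size t = n, uniq t,
    forall z, z \in t -> E z &
    \sum_(x <- t) \sum_(y <- t) off_diagonal_kernel D x y <=
    n%:R ^+ 2 * (ln D - ln c)].
  have pt : perm_eq (sort <=%R t) t by rewrite perm_sort.
  exists (sort <=%R t); split.
  - by rewrite size_sort.
  - by rewrite sort_uniq.
  - exact: sort_sorted le_total _.
  - by move=> z; rewrite mem_sort; exact: tE.
  - rewrite (perm_big _ pt)/= (eq_bigr _ (fun x _ => perm_big _ pt)); exact: tD.
elim: n => [|n [t [tn tu tE tD]]].
  by exists [::]; split => //; rewrite big_nil expr0n mul0r.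
have [x Ex xt] := spread tE.
have cn0 : 0 < c ^+ size t by rewrite exprn_gt0.
have xNt : x \notin t.
  apply/negP => xt'; move: (lt_le_trans cn0 xt).
  by rewrite (big_rem x xt')/= subrr normr0 mul0r ltxx.
have d0 z : z \in t -> 0 < `|x - z|.
  by move=> zt; rewrite normr_gt0 subr_eq0; apply: contraNneq xNt => ->.
have row : \sum_(y <- t) off_diagonal_kernel D x y <= n%:R * (ln D - ln c).
  have -> : \sum_(y <- t) off_diagonal_kernel D x y =
      \sum_(y <- t) (ln D - ln `|x - y|).
    rewrite big_seq [RHS]big_seq; apply: eq_bigr => y yt.
    rewrite /off_diagonal_kernel ifF; last first.
      by apply/negbTE; apply: contraNneq xNt => ->.
    apply/max_idPr; rewrite subr_ge0 ler_ln ?posrE ?d0//.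
    by apply: ED => //; exact: tE.
  rewrite sumrB big_const_seq count_predT iter_addr_0 tn.
  rewrite mulrBr mulr_natl lerD2l.
  rewrite lerN2 -ln_prod// mulr_natl -lnXn// ler_ln ?posrE -?tn//.
  exact: lt_le_trans xt.
exists (x :: t); split => //=.
- by rewrite tn.
- by rewrite xNt.
- by move=> z; rewrite inE => /predU1P[->//|]; exact: tE.
rewrite !big_cons {1}/off_diagonal_kernel eqxx add0r.
rewrite [X in _ + X <= _](eq_bigr (fun i => off_diagonal_kernel D i x +
    \sum_(y <- t) off_diagonal_kernel D i y)); last first.
  by move=> i _; rewrite big_cons.
rewrite big_split/=.
have -> : \sum_(i <- t) off_diagonal_kernel D i x =
    \sum_(i <- t) off_diagonal_kernel D x i.
  by apply: eq_bigr => i _; exact: off_diagonal_kernelC.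
have -> : n.+1%:R ^+ 2 * (ln D - ln c) =
   n%:R * (ln D - ln c) + (n%:R * (ln D - ln c) + n%:R ^+ 2 * (ln D - ln c))
   + (ln D - ln c).
  by rewrite -natr1; ring.
by rewrite ler_wpDr ?subr_ge0// !lerD.
Qed.

End leja.

(** * Selection of monotone functions *)

Section monotone_selection.
Context {R : realType}.

(** Any two points of this set are separated by the rationals [z] attached to
    them, since [f] at their midpoint lies between these rationals. *)
Lemma countable_jump (f : R -> R) : {homo f : x y / x <= y} ->
  countable [set u | exists z : rat, (forall r, r < u -> f r < ratr z) /\
                                     (forall r, u < r -> ratr z < f r)].
Proof.
move=> fnd; set B := [set u | _].
have /choice[z zP] : forall u, exists z : rat, B u ->
    (forall r, r < u -> f r < ratr z) /\ (forall r, u < r -> ratr z < f r).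
  move=> u; have [[z zu]|nB] := pselect (B u); first by exists z.
  by exists 0.
apply/countable_injP; exists (pickle \o z) => u v.
rewrite !inE => Bu Bv /= /(pcan_inj pickleK_inv) zuv.
have lt_absurd (x y : R) : B x -> B y -> z x = z y -> x < y -> False.
  move=> Bx By zxy xy.
  have [xm my] : x < (x + y) / 2 /\ (x + y) / 2 < y by split; lra.
  have := lt_trans ((zP _ Bx).2 _ xm) ((zP _ By).1 _ my).
  by rewrite zxy ltxx.
have [uv|vu|//] := ltgtP u v; exfalso.
  exact: lt_absurd uv.
exact: lt_absurd vu.
Qed.

Lemma cvg_at_nonjump (f : R -> R) (g : nat -> R -> R) (u : R) :
  {homo f : x y / x <= y} -> (forall k, {homo g k : x y / x <= y}) ->
  (forall r : rat, (fun k => g k (ratr r)) @ \oo --> f (ratr r)) ->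
  ~ (exists z : rat, (forall r, r < u -> f r < ratr z) /\
                     (forall r, u < r -> ratr z < f r)) ->
  (fun k => g k u) @ \oo --> f u.
Proof.
move=> fnd gnd gf nj.
have split_z (z : rat) : (exists2 r, r < u & ratr z <= f r) \/
    (exists2 r, u < r & f r <= ratr z).
  have [|h1] := pselect (exists2 r, r < u & ratr z <= f r); first by left.
  have [|h2] := pselect (exists2 r, u < r & f r <= ratr z); first by right.
  exfalso; apply: nj; exists z; split => r ru; rewrite ltNge; apply/negP => fr.
    by apply: h1; exists r.
  by apply: h2; exists r.
apply/cvgrPdist_lt => e e0.
have e2 : 0 < e / 2 by lra.
have [z1] := @rat_in_itvoo R (f u - e / 2) (f u) ltac:(lra).
have [z2] := @rat_in_itvoo R (f u) (f u + e / 2) ltac:(lra).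
rewrite !in_itv/= => /andP[z2l z2r] /andP[z1l z1r].
have [[r1 r1u fr1]|[r ru fr]] := split_z z1; last first.
  by have := fnd _ _ (ltW ru); lra.
have [[r ru fr]|[r2 r2u fr2]] := split_z z2.
  by have := fnd _ _ (ltW ru); lra.
have [s1] := @rat_in_itvoo R _ _ r1u; have [s2] := @rat_in_itvoo R _ _ r2u.
rewrite !in_itv/= => /andP[s2l s2r] /andP[s1l s1r].
have f1 := fnd _ _ (ltW s1l); have f2 := fnd _ _ (ltW s2r).
near=> k.
have g1 := gnd k _ _ (ltW s1r); have g2 := gnd k _ _ (ltW s2l).
have : `|f (ratr s1) - g k (ratr s1)| < e / 2.
  by near: k; move/cvgrPdist_lt : (gf s1); apply.
have : `|f (ratr s2) - g k (ratr s2)| < e / 2.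
  by near: k; move/cvgrPdist_lt : (gf s2); apply.
rewrite !ltr_norml => /andP[? ?] /andP[? ?]; apply/andP; split; lra.
Unshelve. all: end_near. Qed.

(** Helly's theorem. Tychonoff's theorem gives a pointwise cluster point [f];
    only finitely many points can be controlled by a neighbourhood of [f], so
    the subsequence is chosen to converge at the rationals, and monotonicity
    extends the convergence to every point where [f] does not jump. *)
Lemma monotone_selection (E : set R) (q : nat -> R -> R) :
  compact E -> (forall n u, E (q n u)) ->
  (forall n, {homo q n : x y / x <= y}) ->
  exists (f : R -> R) (nu : nat -> nat), [/\ (forall u, E (f u)),
    {homo f : x y / x <= y}, (forall k, k <= nu k)%N &
    exists2 B : set R, countable B &
      forall u, ~ B u -> (fun k => q (nu k) u) @ \oo --> f u].
Proof.
move=> Ec qE qnd.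
pose F : set_system (prod_topology (fun _ : R => R)) := q @ \oo.
have FF : ProperFilter F by exact: (fmap_proper_filter q eventually_filter).
have Fc := tychonoff (fun _ : R => Ec).
have [f [fE fc]] : [set f : prod_topology (fun _ : R => R) |
    forall i, E (f i)] `&` cluster F !=set0.
  by apply: Fc; exists 0%N => // n _ u; exact: qE.
have close (s : seq R) (e : R) (k : nat) : 0 < e ->
    exists n, (k <= n)%N /\ forall u, u \in s -> `|f u - q n u| < e.
  move=> e0.
  have nb : nbhs f [set g : prod_topology (fun _ : R => R) |
      forall u, u \in s -> `|f u - g u| < e].
    elim: s => [|u s IH]; first by apply: filterS filterT => g _ u.
    have nu : nbhs f [set g : prod_topology (fun _ : R => R) |
        `|f u - g u| < e].
      have hb : nbhs (f u) (ball (f u) e) by exact: nbhsx_ballx.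
      exact: (@proj_continuous R (fun _ => R) u f _ hb).
    apply: filterS2 nu IH => g gu gs v.
    by rewrite inE => /predU1P[->//|]; exact: gs.
  have qk : F (q @` [set n | (k <= n)%N]).
    by exists k => // n /= kn; exists n.
  have [g [[n /= kn <-] gs]] := fc _ _ qk nb.
  by exists n.
have fnd : {homo f : x y / x <= y}.
  move=> x y xy; apply/ler_addgt0Pr => e e0.
  have e2 : 0 < e / 2 by lra.
  have [n [_ h]] := close [:: x; y] (e / 2) 0%N e2.
  have := h x; have := h y; rewrite !inE !eqxx orbT => /(_ isT) + /(_ isT).
  have := qnd n _ _ xy; rewrite !ltr_norml => ? /andP[? ?] /andP[? ?]; lra.
pose rats k : seq R := [seq ratr (odflt 0 (unpickle i)) | i <- iota 0 k].
have /choice[nu nuP] : forall k, exists n, (k <= n)%N /\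
    forall u, u \in rats k -> `|f u - q n u| < k.+1%:R^-1.
  by move=> k; apply: close; rewrite invr_gt0.
exists f, nu; split => //; first by move=> k; exact: (nuP k).1.
have qr (r : rat) : (fun k => q (nu k) (ratr r)) @ \oo --> f (ratr r).
  apply/cvgrPdist_lt => e e0; near=> k.
  apply: (@lt_trans _ _ k.+1%:R^-1).
    apply: (nuP k).2; apply/mapP; exists (pickle r); last by rewrite pickleK.
    rewrite mem_iota add0n/=; near: k; exact: nbhs_infty_gt.
  near: k; exact: near_infty_natSinv_lt (PosNum e0).
exists [set u | exists z : rat, (forall r, r < u -> f r < ratr z) /\
                                     (forall r, u < r -> ratr z < f r)].
  exact: countable_jump.
by move=> u nj; apply: (@cvg_at_nonjump f (q \o nu)) => // k; exact: qnd.
Unshelve. all: end_near. Qed.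

End monotone_selection.

(** * Measures of small energy and monic polynomials small on a compact set *)

Section grid.
Context {R : realType}.
Local Notation T := (measurableTypeR R).
Local Notation U := (uniform_prob (@ltr01 R)).
Implicit Types (n i : nat) (u v : R).

(** The index of the cell containing [u] when the interval from [0] to [1] is
    cut into [n.+1] equal cells. Truncating outside of this interval makes the
    function monotone on the whole line. *)
Definition grid n u : nat := minn (Num.trunc (u * n.+1%:R)) n.

Lemma grid_le n u : (grid n u <= n)%N.
Proof. exact: geq_minr. Qed.

Lemma grid_nd n u v : u <= v -> (grid n u <= grid n v)%N.
Proof.
move=> uv; rewrite leq_min geq_minr andbT (leq_trans (geq_minl _ _))//.
by apply: le_truncn; rewrite ler_pM2r// ltr0n.
Qed.

(** Fibres of a monotone function are intervals. *)
Lemma measurable_grid n : measurable_fun [set: T] (grid n).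
Proof.
move=> _ A _; rewrite setTI.
have -> : grid n @^-1` A = \bigcup_(i in A) (grid n @^-1` [set i]).
  apply/seteqP; split => u /=; first by move=> Au; exists (grid n u).
  by case=> i /[swap] <-.
apply: bigcup_measurable => i _.
apply: is_interval_measurable => u v /= ui vi w.
move=> /andP[uw wv]; apply/eqP; rewrite eqn_leq.
by rewrite -[X in (_ <= X)%N && _]vi -[X in _ && (X <= _)%N]ui !grid_nd.
Qed.

Lemma uniform_lebesgue (A : set T) : measurable A ->
  U A = lebesgue_measure (A `&` `[0, 1]%classic).
Proof.
move=> mA.
have -> : U A = (\int[U]_u (\1_A u)%:E)%E by rewrite integral_indic// setIT.
rewrite integral_uniform//; last first.
  by apply/measurable_EFinP; exact: measurable_indic.
by rewrite subr0 invr1 mul1e integral_indic.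
Qed.

Lemma uniform_ae01 : {ae U, forall u, 0 <= u < 1}.
Proof.
exists (~` `[0, 1[%classic); split.
- exact: measurableC.
- apply: eq_trans (uniform_lebesgue (measurableC _)) _ => //.
  rewrite (_ : _ `&` _ = [set 1]) ?lebesgue_measure_set1//.
  apply/seteqP; split => u /=; rewrite !in_itv/=; last first.
    by move=> ->; rewrite ltxx lexx ler01 andbF.
  move=> [/negP + /andP[u0 u1]]; rewrite u0/= -leNgt => ?.
  by apply/eqP; rewrite eq_le u1.
- by move=> u /= h; rewrite in_itv.
Qed.

Lemma uniform_ae_countable (B : set R) : countable B -> {ae U, forall u, ~ B u}.
Proof.
move=> cB.
have mB : measurable (B : set T).
  by apply: countable_measurable => // t; exact: measurable_set1.
exists B; split => //; last by move=> u /contrapT.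
apply: eq_trans (uniform_lebesgue mB) _.
apply: countable_lebesgue_measure0; apply: sub_countable cB.
by apply: subset_card_le => u [].
Qed.

Lemma uniform_grid n i : (i <= n)%N ->
  (U (grid n @^-1` [set i]) <= (n.+1%:R^-1)%:E)%E.
Proof.
move=> ni; set A := _ @^-1` _.
have mA : measurable (A : set T).
  by rewrite -[A]setTI; apply: measurable_grid.
have N0 : 0 < n.+1%:R :> R by rewrite ltr0n.
have -> : U A = lebesgue_measure (A `&` `[0, 1]%classic).
  exact: uniform_lebesgue.
have le1 : A `&` `[0, 1] `<=` `[i%:R / n.+1%:R, i.+1%:R / n.+1%:R].
  move=> u [/= ui]; rewrite !in_itv/= => /andP[u0 u1].
  have uN : 0 <= u * n.+1%:R by rewrite mulr_ge0.
  have /andP[t1 t2] := truncn_itv uN.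
  rewrite ler_pdivrMr// ler_pdivlMr//.
  move: ui; rewrite /A/= /grid.
  have [tn|nt] := leqP (Num.trunc (u * n.+1%:R)) n.
    by move=> ti; rewrite ti in t1 t2; rewrite t1 ltW.
  move=> ti; rewrite -ti; apply/andP; split.
    by rewrite (le_trans _ t1)// ler_nat ltnW.
  by rewrite ler_piMl// ltW.
have leb : lebesgue_measure `[i%:R / n.+1%:R, i.+1%:R / n.+1%:R : R]%classic =
    (n.+1%:R^-1)%:E.
  rewrite lebesgue_measure_itv/= lte_fin ltr_pM2r ?invr_gt0//.
  rewrite ltr_nat leqnn -EFinB.
  by rewrite -mulrBl -natr1 addrAC subrr add0r mul1r.
rewrite -leb; apply: le_measure; rewrite ?inE//.
exact: measurableI.
Qed.

Lemma integral_grid_le n (h : nat -> R) : (forall i, 0 <= h i) ->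
  (\int[U]_u (h (grid n u))%:E <= (n.+1%:R^-1 * \sum_(i < n.+1) h i)%:E)%E.
Proof.
move=> h0.
have mG i : measurable (grid n @^-1` [set i] : set T).
  by rewrite -[X in measurable X]setTI; apply: measurable_grid.
have -> : (\int[U]_u (h (grid n u))%:E =
    \int[U]_u (\sum_(i < n.+1)
       (h i)%:E * (\1_(grid n @^-1` [set val i]) u)%:E))%E.
  apply: eq_integral => u _.
  have gu : (grid n u < n.+1)%N by rewrite ltnS grid_le.
  rewrite (bigD1 (Ordinal gu))//= indicE mem_set//= mule1 big1 ?adde0//.
  move=> i /eqP iu; rewrite indicE memNset ?mule0//= => ui; apply: iu.
  exact/val_inj.
have mi i : measurable_fun [set: T] (fun u => (\1_(grid n @^-1` [set i]) u)%:E).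
  by apply/measurable_EFinP; exact: measurable_indic.
rewrite ge0_integral_sum//; last 2 first.
- by move=> i; exact: measurable_funeM.
- by move=> i u _; rewrite mule_ge0// lee_fin.
rewrite mulr_sumr -sumEFin; apply: lee_sum => i _.
rewrite ge0_integralZl// ?lee_fin// integral_indic// setIT mulrC EFinM.
apply: lee_wpmul2l; first by rewrite lee_fin.
by apply: uniform_grid; rewrite -ltnS ltn_ord.
Qed.

End grid.

Section small_monic.
Context {R : realType}.
Local Notation T := (measurableTypeR R).
Local Notation U := (uniform_prob (@ltr01 R)).
Variables (E : set R) (D c : R).
Hypotheses (Ec : compact E) (D0 : 0 < D) (c0 : 0 < c).
Hypothesis ED : forall x y, E x -> E y -> `|x - y| <= D.
Hypothesis spread : forall s : seq R, (forall z, z \in s -> E z) ->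
  exists2 x, E x & c ^+ size s <= \prod_(z <- s) `|x - z|.

Lemma measurable_grid_fun n (g : nat -> \bar R) :
  measurable_fun [set: T] (fun u => g (grid n u)).
Proof.
by apply: (@measurableT_comp _ _ _ _ _ _ g) => //; exact: measurable_grid.
Qed.

(** The sorted greedy points give step functions [q n] of [u] between [0] and
    [1], the quantile functions of the empirical measures. A subsequence
    converges almost everywhere to some [f], and the image of the uniform
    measure under [f] is the weak limit sought. Its energy is bounded by
    applying Fatou's lemma in each variable: for [u != v] the cells of [u] and
    [v] are eventually distinct, so ignoring the diagonal does not change the
    limit. *)
Lemma spread_energy : exists sigma : probability T R, sigma E = 1%E /\
  (\int[sigma]_x log_potential sigma D x <= (ln D - ln c)%:E)%E.
Proof.
have mE : measurable (E : set T) by exact: compact_measurable.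
have /choice[t tP] : forall n, exists t : seq R, [/\ size t = n.+1, uniq t,
  sorted <=%R t, forall z, z \in t -> E z &
  \sum_(x <- t) \sum_(y <- t) off_diagonal_kernel D x y <=
    n.+1%:R ^+ 2 * (ln D - ln c)].
  by move=> n; exact: leja_energy.
pose q (n : nat) (u : R) := nth 0 (t n) (grid n u).
have gt n (u : R) : (grid n u < size (t n))%N.
  by have [-> _ _ _ _] := tP n; rewrite ltnS grid_le.
have qE n (u : R) : E (q n u).
  by have [_ _ _ h _] := tP n; apply: h; exact: mem_nth.
have qnd n : {homo q n : x y / x <= y}.
  move=> x y xy; have [_ _ st _ _] := tP n.
  by apply: (sorted_leq_nth (@le_trans _ _) (@lexx _ _) 0 st);
    rewrite ?inE//; exact: grid_nd.
have [f [nu [fE fnd nuk [B cB fB]]]] := monotone_selection Ec qE qnd.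
have mf : @measurable_fun _ _ T T [set: T] f by exact: nondecreasing_measurable.
pose X : {RV U >-> T} := @mfun_Sub _ _ T T _ (mem_set mf).
pose sigma : probability T R := distribution U X.
have XE : X = f :> (_ -> _) by [].
exists sigma; split.
  have -> : sigma E = U (f @^-1` E) by [].
  have -> : f @^-1` E = setT by apply/seteqP; split => // u _; exact: fE.
  exact: probability_setT.
pose K (u v : R) := log_kernel D (f u) (f v).
have potE x : log_potential sigma D x = (\int[U]_v log_kernel D x (f v))%E.
  rewrite /log_potential ge0_integral_distribution//.
  - exact: measurable_log_kernel.
  - by move=> y; exact: log_kernel_ge0.
have -> : (\int[sigma]_x log_potential sigma D x = \int[U]_u \int[U]_v K u v)%E.
  have mW : measurable_fun [set: T] (log_potential sigma D) :=
    measurable_log_potential sigma D.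
  have W0 y : (0 <= log_potential sigma D y)%E := log_potential_ge0 sigma D y.
  apply: eq_trans (ge0_integral_distribution X mW W0) _.
  by apply: eq_integral => u _; exact: potE.
pose h k (i j : nat) :=
  off_diagonal_kernel D (nth 0 (t (nu k)) i) (nth 0 (t (nu k)) j).
have h0 k i j : 0 <= h k i j by exact: off_diagonal_kernel_ge0.
pose J k (u : R) := (\int[U]_v (h k (grid (nu k) u) (grid (nu k) v))%:E)%E.
have mK : measurable_fun [set: T * T] (fun z : T * T => K z.1 z.2).
  apply: (@measurableT_comp _ _ _ _ _ _ (fun z : T * T => log_kernel D z.1 z.2)
    _ (fun z : T * T => (f z.1, f z.2))); first exact: measurable_log_kernel2.
  by apply: measurable_fun_pair; apply: measurableT_comp.
have mJ k : measurable_fun [set: T] (J k).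
  exact: (measurable_grid_fun _
    (fun i => \int[U]_v (h k i (grid (nu k) v))%:E)%E).
have J0 k u : (0 <= J k u)%E by apply: integral_ge0 => v _; rewrite lee_fin.
have Jle k : (\int[U]_u J k u <= (ln D - ln c)%:E)%E.
  have [st _ _ _ tD] := tP (nu k).
  set N := nu k in st tD *.
  pose H i := N.+1%:R^-1 * \sum_(j < N.+1) h k i j.
  have H0 i : 0 <= H i by rewrite mulr_ge0 ?sumr_ge0 ?invr_ge0.
  apply: (@le_trans _ _ (\int[U]_u (H (grid N u))%:E)%E).
    apply: ge0_le_integral => //.
    - exact: (measurable_grid_fun _ (EFin \o H)).
    - by move=> u _; exact: integral_grid_le.
  apply: le_trans (integral_grid_le _ H0) _.
  rewrite lee_fin /H -mulr_sumr mulrA.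
  move: tD; rewrite (big_nth 0) st big_mkord.
  under eq_bigr do rewrite (big_nth 0) st big_mkord.
  rewrite -ler_pdivrMl ?exprn_gt0//; apply: le_trans.
  by rewrite expr2 invfM.
have good : {ae U, forall u, 0 <= u < 1 /\ ~ B u}.
  by apply: ae_impl2 uniform_ae01 (uniform_ae_countable cB).
have cvgK u v : 0 <= u < 1 /\ ~ B u -> 0 <= v < 1 /\ ~ B v -> u < v ->
  (fun k => (h k (grid (nu k) u) (grid (nu k) v))%:E) @ \oo --> K u v.
  move=> [/andP[u0 u1] nBu] [/andP[v0 v1] nBv] uv.
  have e0 : 0 < v - u by lra.
  apply: cvg_trans (cvg_log_kernel D0 (fB _ nBu) (fB _ nBv)).
  apply: near_eq_cvg; near=> k.
  rewrite -off_diagonal_kernelE// /q nth_uniq//; last by case: (tP (nu k)).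
  have [st _ _ _ _] := tP (nu k).
  have kv : k.+1%:R^-1 < v - u.
    by near: k; exact: near_infty_natSinv_lt (PosNum e0).
  (* The cells of [u] and [v] have different indices once the cells are shorter
     than [v - u]. *)
  have Nv : 1 <= (v - u) * (nu k).+1%:R.
    rewrite -ler_pdivrMr// mul1r (le_trans _ (ltW kv))//.
    by rewrite lef_pV2 ?posrE// ler_nat ltnS; exact: nuk.
  have N0 : 0 < (nu k).+1%:R :> R by [].
  rewrite neq_ltn; apply/orP; left; rewrite /grid.
  have uN : 0 <= u * (nu k).+1%:R by rewrite mulr_ge0.
  have vN : 0 <= v * (nu k).+1%:R by rewrite mulr_ge0.
  have vlt : v * (nu k).+1%:R < (nu k).+1%:R by rewrite gtr_pMl.
  have tv : (Num.trunc (v * (nu k).+1%:R) <= nu k)%N by rewrite truncn_le_nat.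
  rewrite (minn_idPl tv).
  apply: (@leq_ltn_trans (Num.trunc (u * (nu k).+1%:R))); first exact: geq_minl.
  rewrite truncn_ge_nat// -natr1.
  have := truncn_le (u * (nu k).+1%:R); rewrite uN; lra.
have hC k i j : h k i j = h k j i by exact: off_diagonal_kernelC.
have KC u v : K u v = K v u by exact: log_kernelC.
apply: (le_trans _ (limn_einf_le Jle)).
apply: ae_fatou => //.
- by apply: (measurable_fun_fubini_tonelli_F _ mK) => z; exact: log_kernel_ge0.
- by move=> u; apply: integral_ge0 => v _; exact: log_kernel_ge0.
apply: (ae_impl _ good) => u gu.
apply: ae_fatou.
- move=> k.
  exact: (measurable_grid_fun _ (fun j => (h k (grid (nu k) u) j)%:E)).
- by move=> k v; rewrite lee_fin.
- exact: (measurable_fun_pair2 u mK).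
- by move=> v; exact: log_kernel_ge0.
apply: ae_impl2 good (uniform_ae_countable (@countable1 _ u)) => v gv /eqP/= vu.
have [uv|uv|uv] := ltgtP u v.
- by rewrite (cvg_limn_einf_sup (cvgK _ _ gu gv uv)).1.
- rewrite KC -(cvg_limn_einf_sup (cvgK _ _ gv gu uv)).1.
  by under eq_fun do rewrite hC.
- by rewrite uv eqxx in vu.
Unshelve. all: end_near. Qed.

End small_monic.

Section chebyshev.
Context {R : realType}.
Local Notation T := (measurableTypeR R).

Lemma compact_dist_bounded (E : set R) : compact E ->
  exists2 D, 0 < D & forall x y, E x -> E y -> `|x - y| <= D.
Proof.
move=> /compact_bounded[M [_ /(_ (`|M| + 1))]] h.
have hM x : E x -> `|x| <= `|M| + 1.
  by move=> Ex; apply: h => //; rewrite (le_lt_trans (ler_norm _)) ?ltrDl.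
exists (2 * (`|M| + 1)); first by rewrite mulr_gt0// ltr_wpDl.
move=> x y /hM xM /hM yM; apply: le_trans (ler_normB _ _) _; lra.
Qed.

(** The failure of the conclusion for the polynomials with all their roots in
    [E] is the hypothesis of [spread_energy], which would produce a measure on
    [E] of energy below the Robin constant. *)
Lemma exists_small_monic (E : set R) (c : R) : compact E -> E !=set0 -> 0 < c ->
  ((- ln c)%:E < robin_constant E)%E ->
  exists Q : {poly R}, [/\ Q \is monic, (1 < size Q)%N &
    forall x, E x -> `|Q.[x]| < c ^+ (size Q).-1].
Proof.
move=> Ec [x0 Ex0] c0 cr; apply: contrapT => nQ.
have [D D0 ED] := compact_dist_bounded Ec.
have spread (s : seq R) : (forall z, z \in s -> E z) ->
    exists2 x, E x & c ^+ size s <= \prod_(z <- s) `|x - z|.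
  move=> sE; case: s sE => [|y s] sE; first by exists x0; rewrite ?big_nil.
  apply: contrapT => nx; apply: nQ.
  exists (\prod_(z <- y :: s) ('X - z%:P)); rewrite size_prod_XsubC.
  split => //.
    exact: monic_prod_XsubC.
  move=> x Ex; rewrite horner_prod normr_prod.
  under eq_bigr do rewrite hornerXsubC.
  by rewrite ltNge; apply/negP => h; apply: nx; exists x.
have [sigma [sE sD]] := spread_energy Ec D0 c0 ED spread.
move: cr; apply/negP; rewrite -leNgt.
apply: (@le_trans _ _ (log_energy sigma)).
  by apply: ereal_inf_lbound; exists sigma.
have mE : measurable (E : set T) by exact: compact_measurable.
have ED' : {in E &, forall x y, `|x - y| <= D}.
  by move=> x y; rewrite !inE; exact: ED.
move: sD; rewrite (log_energyE mE sE D0 ED').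
by rewrite -leeBrDr// -EFinB addrAC subrr add0r.
Qed.

End chebyshev.

(** * Orthonormal polynomials and Jacobi parameters *)

Section support.
Context {R : realType}.
Local Notation T := (measurableTypeR R).

(** The complement of the support is covered by the null intervals with
    rational ends, which are countably many. *)
Lemma ae_msupport (mu : {measure set T -> \bar R}) :
  {ae mu, forall x, msupport mu x}.
Proof.
pose F (n : nat) : set T :=
  if (unpickle n : option (rat * rat)) is Some pq then
    (if mu `]ratr pq.1, ratr pq.2[%classic == 0%E
     then `]ratr pq.1, ratr pq.2[%classic else set0)
  else set0.
have FN n : mu.-negligible (F n).
  rewrite /F; case: unpickle => [[p q]/=|]; last exact: negligible_set0.
  case: eqP => [pq0|_]; last exact: negligible_set0.
  by exists `]ratr p, ratr q[%classic; split => //; exact: measurable_itv.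
apply: negligibleS (negligible_bigcup FN) => x /= nx.
have [V [oV Vx V0]] : exists V, [/\ open V, V x & mu V = 0%E].
  apply: contrapT => nV; apply: nx => V oV Vx; rewrite lt0e measure_ge0 andbT.
  by apply/eqP => V0; apply: nV; exists V.
have [e /= e0 eV] : exists2 e, 0 < e & ball x e `<=` V.
  by have /nbhs_ballP[e /= e0 eV] := open_nbhs_nbhs (conj oV Vx); exists e.
have [p] := @rat_in_itvoo R (x - e) x ltac:(lra).
have [q] := @rat_in_itvoo R x (x + e) ltac:(lra).
rewrite !in_itv/= => /andP[q1 q2] /andP[p1 p2].
have [k kpq] : exists k, unpickle k = Some (p, q).
  by exists (pickle (p, q)); exact: pickleK.
exists k; first exact: I.
rewrite /F kpq ifT.
  by rewrite /= in_itv/= p2 q1.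
rewrite eq_le measure_ge0 andbT -V0; apply: le_measure; rewrite ?inE//.
  exact: open_measurable.
move=> y /=; rewrite in_itv/= => /andP[y1 y2]; apply: eV.
by rewrite /ball/= ltr_norml; apply/andP; split; lra.
Qed.

End support.

Section orthogonal.
Context {R : realType}.
Local Notation T := (measurableTypeR R).
Variable mu : {finite_measure set T -> \bar R}.
Hypothesis mu_supp : compact (msupport mu).

Lemma integral_cst_fine (C : R) :
  (\int[mu]_x (cst C%:E x) = (C * fine (mu setT))%:E)%E.
Proof.
rewrite integral_cst//= EFinM; congr (_ * _)%E; apply/esym/fineK.
exact: fin_num_measure.
Qed.

Lemma msupport_bounded :
  exists2 M, 1 <= M & forall x, msupport mu x -> `|x| <= M.
Proof.
have /compact_bounded[M [_ /(_ (`|M| + 1))]] := mu_supp => h.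
exists (`|M| + 1); first by rewrite lerDr.
by move=> x; apply: h; rewrite (le_lt_trans (ler_norm _)) ?ltrDl.
Qed.

Lemma horner_bounded (P : {poly R}) (M : R) :
  exists C, forall x, `|x| <= M -> `|P.[x]| <= C.
Proof.
exists (\sum_(i < size P) `|P`_i| * M ^+ i) => x xM.
rewrite horner_coef; apply: le_trans (ler_norm_sum _ _ _) _.
apply: ler_sum => i _; rewrite normrM normrX ler_wpM2l//.
by rewrite lerXn2r ?nnegrE// (le_trans _ xM).
Qed.

Lemma integrable_horner (P : {poly R}) :
  mu.-integrable [set: T] (fun x => (P.[x])%:E).
Proof.
have mP : measurable_fun [set: T] (fun x => (P.[x])%:E).
  by apply/measurable_EFinP; exact: measurable_horner.
apply/integrableP; split => //.
have [M M1 SM] := msupport_bounded; have [C hC] := horner_bounded P M.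
have C0 : 0 <= C.
  by apply: le_trans (hC 0 _) => //; rewrite normr0 (le_trans _ M1).
apply: (@le_lt_trans _ _ (\int[mu]_x (cst C%:E x))%E); last first.
  by rewrite integral_cst_fine ltry.
apply: ae_ge0_le_integral => //.
- exact: measurableT_comp.
- have aeS : {ae mu, forall x, msupport mu x} := ae_msupport mu.
  apply: (@ae_impl R _ T mu (msupport mu)) aeS => x Sx _ /=.
  by rewrite lee_fin; apply: hC; exact: SM.
Qed.

Definition poly_int (P : {poly R}) : R := fine (\int[mu]_x (P.[x])%:E)%E.

Lemma poly_intE P : (\int[mu]_x (P.[x])%:E)%E = (poly_int P)%:E.
Proof.
by rewrite fineK//; apply: integrable_fin_num => //; exact: integrable_horner.
Qed.

Lemma poly_intD P Q : poly_int (P + Q) = poly_int P + poly_int Q.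
Proof.
apply: EFin_inj; rewrite EFinD -!poly_intE.
rewrite -integralD//; [|exact: integrable_horner..].
by apply: eq_integral => x _; rewrite hornerD EFinD.
Qed.

Lemma poly_intZ a P : poly_int (a *: P) = a * poly_int P.
Proof.
apply: EFin_inj; rewrite EFinM -!poly_intE.
rewrite -integralZl//; last exact: integrable_horner.
by apply: eq_integral => x _; rewrite hornerZ EFinM.
Qed.

Lemma poly_int_sqr_ge0 P : 0 <= poly_int (P ^+ 2).
Proof.
rewrite -lee_fin -poly_intE; apply: integral_ge0 => x _.
by rewrite lee_fin horner_exp sqr_ge0.
Qed.

Lemma poly_int_sqr_le P S : (forall x, msupport mu x -> `|P.[x]| <= S) ->
  poly_int (P ^+ 2) <= S ^+ 2 * fine (mu setT).
Proof.
move=> PS; rewrite -lee_fin -poly_intE -integral_cst_fine.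
apply: ae_ge0_le_integral => //.
- by move=> x _; rewrite lee_fin horner_exp sqr_ge0.
- by apply/measurable_EFinP; exact: measurable_horner.
- by move=> x _; rewrite lee_fin sqr_ge0.
- have aeS : {ae mu, forall x, msupport mu x} := ae_msupport mu.
  apply: (@ae_impl R _ T mu (msupport mu)) aeS => x Sx _ /=.
  rewrite lee_fin horner_exp -real_normK ?num_real// lerXn2r ?nnegrE//.
    by apply: le_trans (PS x Sx).
  exact: PS.
Qed.

Variable p : nat -> {poly R}.
Hypothesis op : orthonormal_polynomials mu p.

Lemma orthonormal_int m n : poly_int (p m * p n) = (m == n)%:R.
Proof.
apply: EFin_inj; rewrite -poly_intE -(op.2 m n).
by apply: eq_integral => x _; rewrite hornerM.
Qed.

(** Subtracting a multiple of [p k] lowers the degree, by induction down to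
    [0]. *)
Lemma orthogonal_lower_degree n (r : {poly R}) :
  (size r <= n)%N -> poly_int (r * p n) = 0.
Proof.
suff : forall k, (k <= n)%N ->
    forall r : {poly R}, (size r <= k)%N -> poly_int (r * p n) = 0.
  by move=> h /(h n (leqnn n)).
elim=> [|k IH] kn {}r.
  rewrite leqn0 size_poly_eq0 => /eqP ->.
  by rewrite -[0](scale0r 0) -scalerAl poly_intZ mul0r.
move=> rk; have [sp lp] := op.1 k.
pose r' := r - (r`_k / lead_coef (p k)) *: p k.
have -> : r = r' + (r`_k / lead_coef (p k)) *: p k by rewrite subrK.
rewrite mulrDl poly_intD -scalerAl poly_intZ orthonormal_int ltn_eqF//.
rewrite mulr0 addr0.
apply: IH; first exact: ltnW.
apply/leq_sizeP => i; rewrite leq_eqVlt coefB coefZ => /predU1P[<-|ki].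
  have -> : (p k)`_k = lead_coef (p k) by rewrite lead_coefE sp.
  by rewrite divfK ?subrr// gt_eqF.
rewrite [(p k)`_i]nth_default ?sp// mulr0 subr0 nth_default//.
exact: leq_trans rk ki.
Qed.

(** The monic multiple of [p n] differs from [Q] by a polynomial of lower
    degree, orthogonal to [p n], so the minimum is Pythagoras's theorem. *)
Lemma monic_sqr_int_min n Q : Q \is monic -> size Q = n.+1 ->
  (lead_coef (p n)) ^- 2 <= poly_int (Q ^+ 2).
Proof.
move=> Qm sQ; have [sp lp] := op.1 n; set k := lead_coef (p n) in lp *.
pose r := Q - k^-1 *: p n.
have sr : (size r <= n)%N.
  apply/leq_sizeP => i; rewrite leq_eqVlt coefB coefZ => /predU1P[<-|ni].
    have -> : (p n)`_n = k by rewrite /k lead_coefE sp.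
    have -> : Q`_n = 1 by move: Qm; rewrite monicE lead_coefE sQ => /eqP.
    by rewrite mulVf ?subrr// gt_eqF.
  by rewrite !nth_default ?mulr0 ?subrr// ?sp ?sQ.
have -> : Q = r + k^-1 *: p n by rewrite subrK.
have -> : (r + k^-1 *: p n) ^+ 2 =
  r ^+ 2 + ((2 * k^-1) *: (r * p n) + k^- 2 *: (p n * p n)).
  rewrite sqrrD -addrA; congr (_ + (_ + _)).
    by rewrite -scalerAr -scaler_nat scalerA.
  by rewrite expr2 -scalerAl -scalerAr scalerA -expr2 exprVn.
rewrite !poly_intD !poly_intZ orthogonal_lower_degree// orthonormal_int eqxx.
by rewrite mulr0 add0r mulr1 lerDr poly_int_sqr_ge0.
Qed.

Lemma lead_coef0_sqr : lead_coef (p 0) ^+ 2 * fine (mu setT) = 1.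
Proof.
have [c p0] : exists c, p 0%N = c%:P.
  by exists (p 0)`_0; apply: size1_polyC; rewrite (op.1 0%N).1.
have := congr1 EFin (orthonormal_int 0 0); rewrite eqxx -poly_intE.
rewrite p0 lead_coefC -polyCM.
under eq_integral do rewrite hornerC.
by rewrite (integral_cst_fine (_ * _)) expr2 => -[].
Qed.

Variables (a b : nat -> R).
Hypothesis a0 : forall n, (0 < n)%N -> 0 < a n.
Hypothesis rec0 : 'X * p 0%N = a 1%N *: p 1%N + b 1%N *: p 0%N.
Hypothesis recS : forall n, (0 < n)%N ->
          'X * p n = a n.+1 *: p n.+1 + b n.+1 *: p n + a n *: p n.-1.

(** Comparing the leading coefficients in the recurrence shows that [a n.+1] is
    the ratio of those of [p n] and [p n.+1]. *)
Lemma jacobi_prodE n :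
  \prod_(1 <= k < n.+1) a k = lead_coef (p 0) / lead_coef (p n).
Proof.
have step m : lead_coef (p m) = a m.+1 * lead_coef (p m.+1).
  have [sp _] := op.1 m; have [sp' _] := op.1 m.+1.
  rewrite !lead_coefE sp sp'/= -[LHS](_ : ('X * p m)`_m.+1 = _); last first.
    by rewrite coefXM.
  case: m sp sp' => [|m] sp sp'.
    by rewrite rec0 coefD !coefZ [in X in _ + X]nth_default ?sp// mulr0 addr0.
  have [sp'' _] := op.1 m.
  rewrite recS// !coefD !coefZ [in X in _ + X + _]nth_default ?sp//.
  by rewrite [in X in _ + X]nth_default ?sp''// !mulr0 !addr0.
have lp m : 0 < lead_coef (p m) by case: (op.1 m).
elim: n => [|n IH]; first by rewrite big_geq// divff// gt_eqF.
rewrite big_nat_recr//= IH (step n); field.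
by rewrite !gt_eqF// a0.
Qed.

Lemma jacobi_prod_gt0 n : 0 < \prod_(1 <= k < n.+1) a k.
Proof.
by rewrite jacobi_prodE divr_gt0//; case: (op.1 0%N) (op.1 n) => _ ? [].
Qed.

Lemma jacobi_prod_le n Q S : Q \is monic -> size Q = n.+1 -> 0 <= S ->
  (forall x, msupport mu x -> `|Q.[x]| <= S) -> \prod_(1 <= k < n.+1) a k <= S.
Proof.
move=> Qm sQ S0 QS.
rewrite -(@ler_pXn2r _ 2)// ?nnegrE ?(ltW (jacobi_prod_gt0 _))//.
rewrite jacobi_prodE expr_div_n.
have l0 : 0 <= lead_coef (p 0) ^+ 2 by rewrite sqr_ge0.
have h := le_trans (monic_sqr_int_min Qm sQ) (poly_int_sqr_le QS).
apply: le_trans (ler_wpM2l l0 h) _.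
by rewrite mulrCA lead_coef0_sqr mulr1.
Qed.

Lemma jacobi_prod_sqr_ge n c :
  (forall Q, Q \is monic -> size Q = n.+1 ->
     (c%:E <= \int[mu]_x (Q.[x] ^+ 2)%:E)%E) ->
  lead_coef (p 0) ^+ 2 * c <= (\prod_(1 <= k < n.+1) a k) ^+ 2.
Proof.
move=> h; have [sp lp] := op.1 n; set k := lead_coef (p n) in lp *.
rewrite jacobi_prodE expr_div_n ler_wpM2l ?sqr_ge0//.
have Qm : k^-1 *: p n \is monic by rewrite monicE lead_coefZ mulVf// gt_eqF.
have := h _ Qm; rewrite size_scale ?invr_eq0 ?gt_eqF// => /(_ sp).
have -> : (\int[mu]_x ((k^-1 *: p n).[x] ^+ 2)%:E =
   \int[mu]_x ((k^- 2 *: (p n * p n)).[x])%:E)%E.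
  by apply: eq_integral => x _; rewrite !hornerZ hornerM exprMn exprVn expr2.
by rewrite poly_intE lee_fin poly_intZ orthonormal_int eqxx mulr1.
Qed.

End orthogonal.

(** * Isolated points of the support and growth of norms *)

Section spectrum.
Context {R : realType}.

(** The closed part of [S] outside of [O] is compact and is covered by open
    sets containing one point of [S] each. *)
Lemma compact_isolated_finite (S O : set R) : compact S -> open O ->
  S `\` isolated S `<=` O ->
  exists F : seq R, forall x, S x -> ~ O x -> x \in F.
Proof.
move=> Sc oO SO; pose C := S `&` ~` O.
have Cc : compact C by apply: compact_closedI => //; exact: open_closedC.
have /choice[V VP] : forall x, exists V : set R,
    C x -> [/\ open V, V x & V `&` S `<=` [set x]].
  move=> x; have [[Sx nOx]|nC] := pselect (C x); last by exists setT.
  have /contrapT[_ [V nV VS]] : ~ ~ isolated S x.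
    by move=> nI; apply: nOx; apply: SO.
  exists V^° => _; split; first exact: open_interior.
    exact: nbhs_singleton (nbhs_interior nV).
  by move=> y [Vy Sy]; rewrite -VS; split => //; exact: interior_subset.
have := Cc; rewrite compact_cover => /(_ _ C V) [].
- by move=> x /VP[].
- by move=> x Cx; exists x => //; have [] := VP _ Cx.
move=> F FC CF; exists (finmap.enum_fset F) => x Sx nOx.
have [y /= yF Vyx] := CF x (conj Sx nOx).
have [_ _ h] := VP y (set_mem (FC _ yF)).
by have -> : x = y by apply: h.
Qed.

End spectrum.

Section regular.
Context {R : realType}.
Local Notation T := (measurableTypeR R).

(** Division by the degree of [Q]: a polynomial of degree [n] is built as [Q ^
    k * G * 'X^r], where [G] vanishes at the points of [F] and [r] is less than
    the degree of [Q], so that [G] and ['X^r] contribute bounded factors. *)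
Lemma norm_poly_le_eventually (S : set R) (Q : {poly R}) (F : seq R) (c M : R) :
  0 < c -> 1 <= M -> (forall x, S x -> `|x| <= M) ->
  Q \is monic -> (1 < size Q)%N ->
  (forall x, S x -> `|Q.[x]| < c ^+ (size Q).-1 \/ x \in F) ->
  exists C : R, forall n, (size F <= n)%N -> exists P : {poly R},
    [/\ P \is monic, size P = n.+1 &
      forall x, S x -> `|P.[x]| <= expR (n%:R * ln c + C)].
Proof.
move=> c0 M1 SM Qm sQ QF.
set m := (size Q).-1 in QF *.
have m0 : (0 < m)%N by rewrite /m -ltnS prednK// ltnW.
pose G := \prod_(z <- F) ('X - z%:P).
have [CG hG] := horner_bounded G M.
pose CG' := Num.max 1 CG.
have CG0 : 0 < CG' by rewrite lt_max ltr01.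
exists (ln CG' + m%:R * ln M + (size F + m)%:R * `|ln c|) => n nF.
pose k := ((n - size F) %/ m)%N; pose r := ((n - size F) %% m)%N.
have nE : n = (m * k + size F + r)%N.
  by rewrite addnAC [(m * k)%N]mulnC -divn_eq subnK.
have Gm : G \is monic by exact: monic_prod_XsubC.
have sG : size G = (size F).+1 by rewrite size_prod_XsubC.
have Qk : Q ^+ k \is monic by exact: monic_exp.
have Xr : 'X^r \is @monic R by exact: monicXn.
have sQk : size (Q ^+ k) = (m * k).+1.
  have := size_exp Q k; rewrite -/m => <-.
  by rewrite prednK// size_poly_gt0 monic_neq0.
exists (Q ^+ k * G * 'X^r); split.
- by rewrite !monicMl// ?monicMr.
- rewrite size_Mmonic ?mulf_neq0 ?monic_neq0// size_Mmonic ?monic_neq0//.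
  by rewrite sQk sG size_polyXn nE; lia.
move=> x Sx; rewrite !hornerM horner_exp hornerXn !normrM !normrX.
have M0 : 0 < M by exact: lt_le_trans M1.
have [Qx|xF] := QF x Sx; last first.
  have -> : G.[x] = 0.
    by apply/eqP; rewrite -[_ == 0]/(root G x) root_prod_XsubC.
  by rewrite normr0 mulr0 mul0r expR_ge0.
have -> : expR (n%:R * ln c +
    (ln CG' + m%:R * ln M + (size F + m)%:R * `|ln c|)) =
  expR (n%:R * ln c + (size F + m)%:R * `|ln c|) * CG' * M ^+ m.
  rewrite -[X in _ * X * _](lnK CG0) -[X in _ * _ * X ^+ _](lnK M0).
  rewrite -expRM_natl -!expRD.
  by congr expR; ring.
apply: ler_pM => //.
- apply: ler_pM => //.
  + apply: (@le_trans _ _ ((c ^+ m) ^+ k)).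
      by rewrite lerXn2r ?nnegrE// ?exprn_ge0 ?ltW.
    rewrite -exprM -[X in X ^+ _](lnK c0) -expRM_natl ler_expR nE.
    have rm : r%:R <= m%:R :> R by rewrite ler_nat ltnW// ltn_mod.
    have h1 : - ((size F)%:R * ln c) <= (size F)%:R * `|ln c|.
      by rewrite -mulrN ler_wpM2l// -normrN ler_norm.
    have h2 : - (r%:R * ln c) <= m%:R * `|ln c|.
      rewrite -mulrN; apply: le_trans (_ : r%:R * `|ln c| <= _).
        by rewrite ler_wpM2l// -normrN ler_norm.
      by rewrite ler_wpM2r.
    rewrite !natrD !mulrDl; lra.
  + by rewrite le_max hG ?orbT// SM.
- apply: (@le_trans _ _ (M ^+ r)).
    by rewrite lerXn2r ?nnegrE ?SM// ltW.
  by rewrite ler_weXn2l// ltnW// ltn_mod.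
Qed.

Lemma cvg_ratio_bounds (u : nat -> R) (l : R) :
  (forall e, 0 < e ->
     exists C, \forall n \near \oo, u n <= n%:R * (l + e) + C) ->
  (forall e, 0 < e ->
     exists C, \forall n \near \oo, n%:R * (l - e) - C <= u n) ->
  (fun n => n%:R^-1 * u n) @ \oo --> l.
Proof.
move=> hu hl; apply/cvgrPdist_le => e e0.
have e2 : 0 < e / 2 by lra.
have [C1 h1] := hu _ e2; have [C2 h2] := hl _ e2.
pose N : nat := (Num.trunc ((`|C1| + `|C2|) / (e / 2))).+1.
near=> n.
have n0 : 0 < n%:R :> R by rewrite ltr0n; near: n; exact: nbhs_infty_gt.
have nN : (`|C1| + `|C2|) <= n%:R * (e / 2).
  rewrite -ler_pdivrMr//; apply: (@le_trans _ _ N%:R).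
    by apply: ltW; exact: truncnS_gt.
  by rewrite ler_nat; near: n; exact: nbhs_infty_ge.
have u1 : u n <= n%:R * (l + e / 2) + C1 by near: n.
have u2 : n%:R * (l - e / 2) - C2 <= u n by near: n.
have C1n := ler_norm C1; have C2n := ler_norm C2.
have C1p := normr_ge0 C1; have C2p := normr_ge0 C2.
have -> : l - n%:R^-1 * u n = n%:R^-1 * (n%:R * l - u n).
  by field; rewrite gt_eqF.
rewrite normrM gtr0_norm ?invr_gt0// ler_pdivrMl// ler_norml.
apply/andP; split; lra.
Unshelve. all: end_near. Qed.

End regular.

(** * Regularity *)

Section pieces.
Context {R : realType}.
Local Notation T := (measurableTypeR R).

(** The sets [1 / k.+1 <= f] increase to a set of full measure. *)
Lemma superlevel_mass (rho : probability T R) (f : T -> R) (eps : R) :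
  measurable_fun [set: T] f -> {ae rho, forall x, 0 < f x} -> eps < 1 ->
  exists delta kappa : R, [/\ 0 < delta, eps < kappa &
    exists mK : measurable [set x : T | delta <= f x],
      rho [set x : T | delta <= f x] = kappa%:E].
Proof.
move=> mf f0 e1.
pose K (k : nat) := [set x : T | k.+1%:R^-1 <= f x].
have mK k : measurable (K k).
  rewrite (_ : K k = f @^-1` `[k.+1%:R^-1, +oo[%classic); last first.
    by apply/seteqP; split => x; rewrite /K/= in_itv/= andbT.
  by rewrite -[X in measurable X]setTI; apply: mf.
have ndK : nondecreasing_seq K.
  move=> m n mn; apply/subsetPset => x /=; apply: le_trans.
  by rewrite lef_pV2 ?posrE// ler_nat ltnS.
have mU : measurable (\bigcup_k K k) by exact: bigcup_measurable.
have rU : rho (\bigcup_k K k) = 1%E.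
  have : rho (~` \bigcup_k K k) = 0%E.
    apply: measure_negligible; first exact: measurableC.
    apply: negligibleS f0 => x /= nx fx; apply: nx.
    have [k _ /(_ k (leqnn _)) kx] := near_infty_natSinv_lt (PosNum fx).
    by exists k => //; exact: ltW.
  rewrite probability_setC// => h.
  have rf : rho (\bigcup_k K k) \is a fin_num by exact: fin_num_measure.
  move: h; rewrite -(fineK rf) => -[/eqP]; rewrite subr_eq0 => /eqP h.
  by congr EFin; rewrite -h.
have cvK : (fun k => rho (K k)) @ \oo --> 1%E.
  by rewrite -rU; exact: nondecreasing_cvg_mu.
have rf k : rho (K k) \is a fin_num by exact: fin_num_measure.
have /fine_cvg/= := cvK.
move=> /(cvgr_gt _)/(_ _ e1)[k _ /(_ k (leqnn _)) /= hk].
exists k.+1%:R^-1, (fine (rho (K k))); split; [by rewrite invr_gt0|exact: hk|].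
by exists (mK k); rewrite fineK.
Qed.

End pieces.

Theorem theorem5p1 (R : realType) (E : set R)
  (E_compact : compact E)
  (E_cap : (0 < capacity E)%E)
  (boundary_cap : capacity (E `\` interior E) = 0%E)
  (rho : probability (measurableTypeR R) R)
  (rho_eq : is_equilibrium_measure E rho)
  (mu : {finite_measure set (measurableTypeR R) -> \bar R})
  (mu_supp : compact (msupport mu))
  (mu_ess : ess_spectrum mu = E)
  (f : measurableTypeR R -> R)
  (f_meas : measurable_fun [set: measurableTypeR R] f)
  (mu_s : {measure set (measurableTypeR R) -> \bar R})
  (mu_decomp : forall A : set (measurableTypeR R), measurable A ->
     mu A = (\int[rho]_(x in A) (f x)%:E + mu_s A)%E)
  (mu_s_sing : mutually_singular rho mu_s)
  (f_pos : {ae rho, forall x, 0 < f x})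
  (a b : nat -> R)
  (ab_jacobi : jacobi_parameters mu a b) :
  (fun n : nat => ((\prod_(1 <= k < n.+1) a k) `^ (n%:R^-1))%:E) @ \oo
    --> capacity E.
Proof.
have [rhoE rhoI] := rho_eq.
have mE : measurable (E : set (measurableTypeR R)) by exact: compact_measurable.
have [x0 Ex0] : E !=set0.
  apply/set0P/eqP => E0; move: rhoE; rewrite E0 measure0 => -[/eqP].
  by rewrite eq_sym oner_eq0.
have [D D0 ED] := compact_dist_bounded E_compact.
have ED' : {in E &, forall x y, `|x - y| <= D}.
  by move=> x y; rewrite !inE; exact: ED.
have energyE (sigma : probability (measurableTypeR R) R) : sigma E = 1%E ->
    (\int[sigma]_x log_potential sigma D x = log_energy sigma + (ln D)%:E)%E.
  by move=> sE; exact: (log_energyE mE sE D0 ED').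
have [r rE] : exists r, robin_constant E = r%:E.
  have : (0 <= \int[rho]_x log_potential rho D x)%E.
    by apply: integral_ge0 => x _; exact: log_potential_ge0.
  rewrite energyE// rhoI; move: E_cap; rewrite /capacity.
  by case: (robin_constant E) => [r| |]//=; [exists r|rewrite ltxx].
have capE : capacity E = (expR (- r))%:E by rewrite /capacity rE.
(* The energy of [rho] for the truncated kernel. *)
pose j := r + ln D.
have jE : (\int[rho]_x log_potential rho D x = j%:E)%E.
  by rewrite energyE// rhoI rE.
have j0 : 0 <= j.
  by rewrite -lee_fin -jE; apply: integral_ge0 => x _; exact: log_potential_ge0.
have jmin (sigma : probability (measurableTypeR R) R) : sigma E = 1%E ->
    (j%:E <= \int[sigma]_x log_potential sigma D x)%E.
  move=> sE; rewrite energyE// /j EFinD leeD2r// -rE.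
  by apply: ereal_inf_lbound; exists sigma.
have EM : exists M, forall x, E x -> - M <= x <= M.
  exists (`|x0| + D) => x Ex; have := ED _ _ Ex Ex0; rewrite -ler_norml => h.
  have := ler_normD x0 (x - x0); rewrite addrC subrK => /le_trans; apply.
  by rewrite lerD2l.
have [M {}EM] := EM.
have [al [be [albe pot]]] := frostman_maximum_principle mE rhoE D0 jE jmin EM.
have [p [op a0 rec0 recS]] := ab_jacobi.
have A0 n : 0 < \prod_(1 <= k < n.+1) a k.
  exact: (jacobi_prod_gt0 op a0 rec0 recS).
have p0 : 0 < lead_coef (p 0%N) ^+ 2.
  by rewrite exprn_gt0//; case: (op.1 0%N).
rewrite capE.
suff key : (fun n : nat => (\prod_(1 <= k < n.+1) a k) `^ (n%:R^-1)) @ \oo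
    --> expR (- r).
  by apply: cvg_EFin; [near=> n|exact: key].
have -> : (fun n : nat => (\prod_(1 <= k < n.+1) a k) `^ (n%:R^-1)) =
    (fun n => expR (n%:R^-1 * ln (\prod_(1 <= k < n.+1) a k))).
  by apply/funext => n; rewrite /powR gt_eqF.
apply: continuous_cvg; first exact: continuous_expR.
apply: cvg_ratio_bounds => e e0.
  pose c := expR (- r + e).
  have lnc : ln c = - r + e by rewrite expRK.
  have [||Q [Qm sQ Qc]] :=
    @exists_small_monic R E c E_compact (ex_intro _ x0 Ex0).
  - exact: expR_gt0.
  - by rewrite rE lnc lte_fin; lra.
  have SO : msupport mu `\` isolated (msupport mu) `<=`
      [set x | `|Q.[x]| < c ^+ (size Q).-1].
    by rewrite -/(ess_spectrum mu) mu_ess => x; exact: Qc.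
  have [F hF] :=
    compact_isolated_finite mu_supp (@open_horner_norm_lt R Q _) SO.
  have [M' M1 SM] := msupport_bounded mu_supp.
  have QF x : msupport mu x -> `|Q.[x]| < c ^+ (size Q).-1 \/ x \in F.
    move=> Sx; have [|nO] := pselect (`|Q.[x]| < c ^+ (size Q).-1).
      by left.
    by right; exact: hF.
  have [C hC] := norm_poly_le_eventually (expR_gt0 _) M1 SM Qm sQ QF.
  exists C; near=> n.
  have nF : (size F <= n)%N by near: n; exact: nbhs_infty_ge.
  have [P [Pm sP PS]] := hC n nF.
  have := jacobi_prod_le mu_supp op a0 rec0 recS Pm sP (expR_ge0 _) PS.
  by rewrite -ler_ln ?posrE ?expR_gt0// expRK -/c lnc.
(* A mass [kappa > j / (j + e)] makes [j / kappa] at most [j + e], that is [ln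
   D - j / kappa >= - r - e]. *)
have je1 : j / (j + e) < 1 by rewrite ltr_pdivrMr; lra.
have [delta [kappa [delta0 kj [mK rK]]]] := superlevel_mass f_meas f_pos je1.
have kappa0 : 0 < kappa.
  by apply: le_lt_trans kj; rewrite divr_ge0// addr_ge0// ltW.
have jk : j / kappa <= j + e.
  move: kj; rewrite ltr_pdivrMr; last by lra.
  by rewrite ler_pdivrMr// mulrC => /ltW.
have le_mu (A : set (measurableTypeR R)) : measurable A ->
    A `<=` [set x | delta <= f x] -> (delta%:E * rho A <= mu A)%E.
  move=> mA Af; rewrite mu_decomp//.
  apply: (@le_trans _ _ (\int[rho]_(x in A) (f x)%:E)%E).
    rewrite -[leLHS](integral_cst rho mA).
    apply: ge0_le_integral => //.
    - by move=> x _; rewrite lee_fin ltW.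
    - by apply/measurable_EFinP; exact: measurable_funTS.
  exact: leeDl.
set g := lead_coef (p 0%N) ^+ 2 * (delta * kappa).
have g0 : 0 < g by exact: mulr_gt0 p0 (mulr_gt0 delta0 kappa0).
exists (`|ln g|); near=> n.
pose y := 2 * (n%:R * (ln D - j / kappa)).
have := @jacobi_prod_sqr_ge R mu mu_supp p op a b a0 rec0 recS n
  (delta * kappa * expR y).
have h Q : Q \is monic -> size Q = n.+1 ->
  ((delta * kappa * expR y)%:E <=
   \int[mu]_x (Q.[x] ^+ 2)%:E)%E.
  move=> Qm sQ.
  have := integral_monic_sqr_ge albe pot mK kappa0 rK delta0 le_mu Qm.
  by rewrite sQ.
move=> /(_ h); rewrite [X in X <= _](_ : _ = g * expR y); last by rewrite mulrA.
rewrite -ler_ln ?posrE; last 2 first.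
- exact: mulr_gt0 g0 (expR_gt0 y).
- exact: exprn_gt0.
rewrite (lnM (x := g)) ?posrE ?expR_gt0// expRK lnXn// -mulr_natl /y => hn.
have n0 : 0 <= n%:R :> R by [].
have : n%:R * (- r - e) <= n%:R * (ln D - j / kappa).
  by rewrite ler_wpM2l//; rewrite /j in jk *; lra.
have : - `|ln g| <= ln g by rewrite lerNl -normrN ler_norm.
have := normr_ge0 (ln g).
lra.
Unshelve. all: end_near. Qed.
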